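(* Let $V=\mathbb{R}^2(x,y)$ with symplectic form $\omega=dx\wedge dy$, and let the conformal symplectic group $H=\mathrm{CSp}(2,\mathbb{R})=\mathrm{Sp}(2,\mathbb{R})\times\mathbb{R}_+$ act linearly on $V$ (with $\mathbb{R}_+$ acting by homotheties). For curves $y=y(x)$ put $$I_2=\frac{y_2}{(xy_1-y)^3},\quad \nabla=\frac1{xy_1-y}\mathcal{D}_x,\quad I_3=\nabla(I_2),\quad I'_3=\frac{I_3^2}{I_2^3},\quad \nabla'=\frac{I_2}{I_3}\nabla .$$ Then the algebra of differential invariants of the $H$-action on the space $J^\infty(V,1)$ of infinite jets of curves in $V$ is freely generated as $\mathcal{A}_H=\langle I'_3\,;\,\nabla'\rangle$.
   Context: $J^k(V,1)$ is the space of $k$-jets of unparametrized curves in $V$, with coordinates $x,y,y_1,\dots,y_k$ on the chart of graphs $y=y(x)$, where $y_l$ is the $l$-th derivative; $\mathcal{D}_x$ is the total derivative. $H$ acts on $J^k(V,1)$ by prolongation. A differential invariant of order $k$ is a function on $J^k(V,1)$ constant on orbits of the prolonged action; differential invariants are taken to be rational functions of the jet-variables (and may be chosen polynomial in jet-variables of sufficiently high order). $\mathcal{A}_H$ is the algebra of all differential invariants. An invariant derivation is a derivation $f\mathcal{D}_x$, $f$ a function on a finite jet space, commuting with the prolonged action. 'Freely generated as $\langle I;\nabla\rangle$' means: every element of the algebra is a rational expression in finitely many of the functions $\nabla^jI$, $j\ge0$, and these functions are algebraically independent (no differential syzygies). *)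

(* Defs.v *)
(* Mathematical Components, with MathComp-Analysis for the derivatives of     *)
(* functions on the reals.                                                    *)
From HB Require Import structures.
From mathcomp Require Import all_boot all_order all_algebra.
From mathcomp Require Import fraction generic_quotient finmap.
From mathcomp Require Import boolp classical_sets reals topology normedtype.
From mathcomp Require Import derive.
(* The notations of these two files clash with those of topology. *)
From mathcomp.multinomials Require Import -(notations) mpoly.
From mathcomp.multinomials Require Import -(notations) monalg.

Set Implicit Arguments.
Unset Strict Implicit.
Unset Printing Implicit Defensive.

Import GRing.Theory Num.Theory.
Import numFieldNormedType.Exports.

Local Open Scope ring_scope.

(* Polynomials in countably many variables: finite linear combinations of     *)
(* finitely supported monomials.                                              *)
Definition polyN (A : idomainType) : Type := malg (cmonom nat) A.

HB.instance Definition _ (A : idomainType) := GRing.ComNzRing.on (polyN A).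

Section PolyNIntegral.

Variable A : idomainType.
Implicit Types p q : polyN A.

(* All the variables of p have an index smaller than var_bound p.             *)
Definition var_bound p : nat :=
  (\max_(m <- msupp p) \max_(i <- finsupp m) i.+1)%N.

Section Truncation.

Variable n : nat.

Definition trunc_mnm (m : cmonom nat) : multinom n :=
  Multinom [tuple m (val i) | i < n].

Definition trunc_mon (m : cmonom nat) : mpoly n A := mpolyX A (trunc_mnm m).

Fact trunc_mon_mmorphism : mmorphism trunc_mon.
Proof.
split=> [m1 m2|]; rewrite /trunc_mon.
  rewrite -mpolyXD; congr (mpolyX _ _); apply/mnmP=> i.
  by rewrite mnmDE !mnmE cmM.
rewrite -mpolyX0; congr (mpolyX _ _); apply/mnmP=> i.
by rewrite mnm0E mnmE cm1.
Qed.

HB.instance Definition _ :=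
  monalg.isMultiplicative.Build (cmonom nat) (mpoly n A) trunc_mon
    trunc_mon_mmorphism.

Definition trunc_poly : malg (cmonom nat) A -> mpoly n A :=
  mmap (@mpolyC n A) trunc_mon.

Lemma trunc_polyM p q : trunc_poly (p * q) = trunc_poly p * trunc_poly q.
Proof. by rewrite /trunc_poly [LHS]rmorphM. Qed.

Definition bounded_vars p :=
  forall m i, m \in msupp p -> i \in finsupp m -> (i < n)%N.

Lemma trunc_mnm_inj p m1 m2 : bounded_vars p ->
  m1 \in msupp p -> m2 \in msupp p -> trunc_mnm m1 = trunc_mnm m2 -> m1 = m2.
Proof.
move=> bp m1p m2p /mnmP eqm; apply/eqP/cmP=> i.
case: (ltnP i n) => [lt_in|le_ni].
  by have := eqm (Ordinal lt_in); rewrite !mnmE.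
suff z m : m \in msupp p -> m i = 0%N by rewrite !z.
move=> mp; apply/eqP; rewrite cmE_eq0; apply/negP=> im.
by have := bp _ _ mp im; rewrite ltnNge le_ni.
Qed.

Lemma trunc_poly_neq0 p : bounded_vars p -> p != 0 -> trunc_poly p != 0.
Proof.
move=> bp p0.
have [m mp] : exists m, m \in msupp p.
  have : msupp p != fset0 by rewrite msupp_eq0.
  by case/fset0Pn=> m ?; exists m.
apply/eqP=> /(congr1 (mpoly.mcoeff (trunc_mnm m))).
rewrite /trunc_poly mmapE raddf_sum mpoly.mcoeff0 (big_fsetD1 m) //=.
rewrite big_seq big1 => [|k]; last first.
  rewrite in_fsetD1 => /andP[km kp].
  rewrite mpoly.mcoeffCM mcoeffX; have [e|_] := eqVneq (trunc_mnm k) _.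
    by move: km; rewrite (trunc_mnm_inj bp kp mp e) eqxx.
  by rewrite mulr0.
rewrite addr0 mpoly.mcoeffCM mcoeffX eqxx mulr1 => /eqP.
by rewrite (monalg.mcoeff_eq0 p) mp.
Qed.

End Truncation.

Lemma var_boundP p : bounded_vars (var_bound p) p.
Proof.
move=> m i mp im; apply: leq_trans (leq_bigmax_seq _ mp isT).
exact: (leq_bigmax_seq _ im isT).
Qed.

Lemma bounded_varsW n1 n2 p :
  (n1 <= n2)%N -> bounded_vars n1 p -> bounded_vars n2 p.
Proof. by move=> le12 bp m i mp im; apply: leq_trans le12; apply: bp mp im. Qed.

Fact polyN_integral p q : p * q = 0 -> (p == 0) || (q == 0).
Proof.
move=> pq0; apply/norP=> -[p0 q0].
pose n := maxn (var_bound p) (var_bound q).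
have p1 : trunc_poly n p != 0.
  exact: trunc_poly_neq0 (bounded_varsW (leq_maxl _ _) (@var_boundP p)) _.
have q1 : trunc_poly n q != 0.
  exact: trunc_poly_neq0 (bounded_varsW (leq_maxr _ _) (@var_boundP q)) _.
have /eqP := trunc_polyM n p q.
by rewrite pq0 /trunc_poly raddf0 eq_sym mulf_eq0 (negPf p1) (negPf q1).
Qed.

Definition polyN_unit : pred (polyN A) := fun p => `[< exists q, q * p = 1 >].

Definition polyN_inv p : polyN A :=
  if pselect (exists q, q * p = 1) is left ex then projT1 (cid ex) else p.

Fact polyN_mulVr : {in polyN_unit, left_inverse 1 polyN_inv *%R}.
Proof.
move=> p /asboolP ex; rewrite /polyN_inv.
by case: pselect => // ex'; case: cid.
Qed.

Fact polyN_unitP p q : q * p = 1 -> polyN_unit p.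
Proof. by move=> qp; apply/asboolP; exists q. Qed.

Fact polyN_inv_out : {in [predC polyN_unit], polyN_inv =1 id}.
Proof.
move=> p /negP np; rewrite /polyN_inv; case: pselect => // ex.
by case: np; apply/asboolP.
Qed.

HB.instance Definition _ :=
  GRing.ComNzRing_hasMulInverse.Build (polyN A)
    polyN_mulVr polyN_unitP polyN_inv_out.
HB.instance Definition _ :=
  GRing.ComUnitRing_isIntegral.Build (polyN A) polyN_integral.

End PolyNIntegral.

Definition constN (A : idomainType) (c : A) : polyN A := mkmalgU mone c.

Definition varN (A : idomainType) (i : nat) : polyN A := mkmalgU (ucm i) 1.

(* The value of p when each variable varN i is replaced by v i and the         *)
(* coefficients are mapped through f.                                         *)
Definition substN (A : idomainType) (B : comNzRingType) (f : A -> B)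
    (v : nat -> B) (p : polyN A) : B :=
  mmap f (fun m : cmonom nat => \prod_(i <- finsupp m) v i ^+ m i) p.

Section JetFunctions.

Variable R : realType.

(* Rational functions on the space of infinite jets. The variable 0 is x and  *)
(* the variable l.+1 is y_l, with y_0 = y. An element involves only finitely  *)
(* many variables, so it is a rational function on some finite jet space.     *)
Definition jetfun : Type := {fraction (polyN R)}.

HB.instance Definition _ := GRing.Field.on jetfun.

Definition to_jetfun (p : polyN R) : jetfun := tofrac p.

Definition jx : jetfun := to_jetfun (varN R 0).
Definition jy (l : nat) : jetfun := to_jetfun (varN R l.+1).

Definition partial_deriv (i : nat) (p : polyN R) : polyN R :=
  \sum_(m <- msupp p) mkmalgU (divcm m (ucm i)) (mcoeff m p *+ m i).

(* D_x = d/dx + \sum_l y_(l+1) d/dy_l, cut off beyond the variables of p.     *)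
Definition total_deriv_poly (p : polyN R) : polyN R :=
  partial_deriv 0 p
  + \sum_(l < var_bound p) varN R l.+2 * partial_deriv l.+1 p.

(* The quotient rule, applied to the chosen representative of the fraction.   *)
Definition total_deriv (F : jetfun) : jetfun :=
  let r : {ratio polyN R} := repr F in
  let p := \n_r in
  let q := \d_r in
  to_jetfun (total_deriv_poly p * q - p * total_deriv_poly q)
  / to_jetfun (q ^+ 2).

(* F is regular at the infinite jet u, with value c.                          *)
Definition has_value (F : jetfun) (u : nat -> R) (c : R) : Prop :=
  exists p q : polyN R,
    [/\ F = to_jetfun p / to_jetfun q,
        substN idfun u q != 0
      & c = substN idfun u p / substN idfun u q].

End JetFunctions.

Section ProlongedAction.

Variable R : realType.

Definition pt (x y : R) : 'cV[R]_2 := \col_i (if i == 0 then x else y).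

Definition omega (p q : 'cV[R]_2) : R := p 0 0 * q 1 0 - p 1 0 * q 0 0.

Definition Sp2 : set 'M[R]_2 :=
  [set A | forall p q, omega (A *m p) (A *m q) = omega p q].

(* A pair (A, c) is the product of A with the homothety of ratio c.           *)
Definition CSp2 : set ('M[R]_2 * R) := [set h | Sp2 h.1 /\ 0 < h.2].

Definition csp_act (h : 'M[R]_2 * R) (p : 'cV[R]_2) : 'cV[R]_2 :=
  h.2 *: (h.1 *m p).

Definition smooth_near (f : R -> R) (a : R) : Prop :=
  \forall t \near a, forall l, derivable (derive1n l f) t 1.

(* The infinite jet at a of the graph of f, in the order x, y, y_1, y_2, etc. *)
Definition jet (f : R -> R) (a : R) (i : nat) : R :=
  if i is l.+1 then derive1n l f a else a.

(* In the chart of graphs, h takes the jet u to the jet v: u is the jet of a  *)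
(* curve y = f x, which h takes near the base point into a curve y = g x,     *)
(* whose jet at the image of the base point is v.                             *)
Definition prolong (h : 'M[R]_2 * R) (u v : nat -> R) : Prop :=
  exists f g : R -> R,
    [/\ smooth_near f (u 0%N) /\ u = jet f (u 0%N),
        smooth_near g (v 0%N) /\ v = jet g (v 0%N),
        v 0%N = csp_act h (pt (u 0%N) (f (u 0%N))) 0 0
      & \forall t \near u 0%N,
          csp_act h (pt t (f t)) 1 0 = g (csp_act h (pt t (f t)) 0 0)].

Definition same_orbit (u v : nat -> R) : Prop :=
  exists2 h, CSp2 h & prolong h u v.

(* The algebra A_H: constancy on orbits wherever F is regular.                *)
Definition differential_invariant : set (jetfun R) :=
  [set F | forall u v, same_orbit u v ->
     forall b c, has_value F u b -> has_value F v c -> b = c].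

(* G is the pullback of F by the prolongation of h.                           *)
Definition is_pullback (h : 'M[R]_2 * R) (F G : jetfun R) : Prop :=
  forall u v, prolong h u v ->
    forall b c, has_value G u b -> has_value F v c -> b = c.

Definition invariant_derivation (nabla : jetfun R -> jetfun R) : Prop :=
  (exists f : jetfun R, forall F, nabla F = f * total_deriv F) /\
  (forall h, CSp2 h -> forall F G,
     is_pullback h F G -> is_pullback h (nabla F) (nabla G)).

(* The value of P at nabla^j I, j >= 0.                                       *)
Definition subst_derivs (I : jetfun R) (nabla : jetfun R -> jetfun R)
    (P : polyN R) : jetfun R :=
  substN (fun c : R => to_jetfun (constN c)) (fun j => iter j nabla I) P.

(* A_H = <I ; nabla>, freely: every invariant is a rational expression in the *)
(* nabla^j I, and conversely, and these are algebraically independent.        *)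
Definition freely_generated (I : jetfun R) (nabla : jetfun R -> jetfun R)
    : Prop :=
  [/\ differential_invariant I,
      invariant_derivation nabla,
      forall F, differential_invariant F <->
        exists P Q : polyN R, subst_derivs I nabla Q != 0 /\
          F = subst_derivs I nabla P / subst_derivs I nabla Q
    & forall P : polyN R, subst_derivs I nabla P = 0 -> P = 0].

End ProlongedAction.

(* Main.v *)
(** Let w = x y1 - y, tau = I3/I2 and I_k = nabla^(k-2) I2. An element of CSp(2,R)
    of scale c prolongs to a field endomorphism phi of the rational jet functions
    with phi (I_k) = c^(-2k) I_k; hence phi fixes I3' and commutes with nabla'. By
    Zariski density of the jets of polynomial graphs (their images under the group
    are graphs, by local inversion), a rational function is an invariant exactly
    when every phi fixes it.

    Generation: as D_x preserves the ring R[x, y, y1, I_2, I_3, ...], it contains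
    all y_k. Fix a generic jet b. A jet u near b is moved by a unique group element
    to the jet v(u) with the base point and direction of b and with
    tau (v(u)) = tau b; its coordinates are polynomials in I_k/tau^k, and these lie
    in the field generated by the nabla'^j I3'. For an invariant F = p/q with
    q(b) <> 0, F u = F (v u) then expresses F in this field.

    Independence: nabla'^j I3' has order exactly j + 3, since
    [d/dy_(k+1), D_x] = d/dy_k, so the top variable of an algebraic relation of
    minimal degree could be removed by differentiating with respect to y_(j+3). *)
Require Import Defs.
From HB Require Import structures.
From mathcomp Require Import all_boot all_order all_algebra.
From mathcomp Require Import fraction generic_quotient finmap.
From mathcomp Require Import boolp classical_sets reals topology normedtype.
From mathcomp Require Import derive realfun.
From mathcomp Require Import ring.
From mathcomp.multinomials Require Import -(notations) monalg.

Set Implicit Arguments.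
Unset Strict Implicit.
Unset Printing Implicit Defensive.

Import Order.TTheory GRing.Theory Num.Theory.
Import numFieldNormedType.Exports.
Local Open Scope ring_scope.

(** * Polynomials in countably many variables and their derivations *)

(** Invariance compares values at pairs of jets of smooth curves and is silent where a function is
    not regular, whereas generation is an identity in a field. The existence of phi already needs a
    passage between the two: substituting the prolonged coordinates must kill no nonzero polynomial,
    and this is seen by pulling a jet back through the inverse group element. Only positive scales
    are available and tau scales by c^(-2), so a jet can be normalized to tau = tau(b) only where
    tau has the sign of tau(b). The comparison of F with its normalized form is therefore made on an
    open set of jets cut out by one polynomial inequality, and density is proved in that relative
    form. The quotients I_k/tau^k have weight zero. Since nabla' = nabla/tau, it sends the k-th
    quotient to the next one, up to a correction in I3', I_4/tau^4 and the k-th quotient itself.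
    This recurrence, started at k = 3 where it can be solved for I_4/tau^4, puts all the quotients
    into the field generated by the nabla'^j I3'. *)

Section Substitution.

Variables (A : idomainType) (B : comNzRingType).

Section Monomials.

Variable v : nat -> B.

Definition mon_subst (m : cmonom nat) : B := \prod_(i <- finsupp m) v i ^+ m i.

Lemma mon_substEw (m : cmonom nat) (d : {fset nat}) : (finsupp m `<=` d)%fset ->
  mon_subst m = \prod_(i <- d) v i ^+ m i.
Proof.
move=> md; rewrite /mon_subst (big_fset_incl _ md) // => i _.
by rewrite -cmE_eq0 => /eqP ->; rewrite expr0.
Qed.

Fact mon_subst_mmorphism : mmorphism mon_subst.
Proof.
split=> [m1 m2|]; last by rewrite /mon_subst mdom1 big_seq_fset0.
rewrite (@mon_substEw m1 (finsupp m1 `|` finsupp m2)%fset) ?fsubsetUl //.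
rewrite (@mon_substEw m2 (finsupp m1 `|` finsupp m2)%fset) ?fsubsetUr //.
rewrite {1}/mon_subst mdomD -big_split; apply: eq_bigr => i _.
by rewrite cmM exprD.
Qed.

HB.instance Definition _ :=
  monalg.isMultiplicative.Build (cmonom nat) B mon_subst mon_subst_mmorphism.

End Monomials.

Variables (f : {rmorphism A -> B}) (v : nat -> B).

Local Notation subst := (substN f v : polyN A -> B).

Fact substN_zmod_morphism : zmod_morphism subst.
Proof. exact: (raddfB (mmap f (mon_subst v))). Qed.

HB.instance Definition _ := GRing.isZmodMorphism.Build (polyN A) B subst
  substN_zmod_morphism.

Fact substN_monoid_morphism : monoid_morphism subst.
Proof.
by split; [exact: (rmorph1 (mmap f (mon_subst v)))
          |exact: (rmorphM (mmap f (mon_subst v)))].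
Qed.

HB.instance Definition _ := GRing.isMonoidMorphism.Build (polyN A) B subst
  substN_monoid_morphism.

Lemma substN_const c : subst (constN c) = f c.
Proof. have -> : subst (constN c) = f c * mon_subst v mone by exact: mmapU.
by rewrite /mon_subst mdom1 big_seq_fset0 mulr1.
Qed.

Lemma substN_var i : subst (varN A i) = v i.
Proof.
have -> : subst (varN A i) = f 1 * mon_subst v (ucm i) by exact: mmapU.
by rewrite rmorph1 mul1r /mon_subst mdomU big_seq_fset1 ucmE eqxx expr1.
Qed.

End Substitution.

Section PolyN.

Variable A : idomainType.
Implicit Types p q : polyN A.

Lemma mkmalgUM (m1 m2 : cmonom nat) (c1 c2 : A) :
  (mkmalgU m1 c1 : polyN A) * mkmalgU m2 c2 = mkmalgU (mulcm m1 m2) (c1 * c2).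
Proof. exact: fgmulUU. Qed.

Lemma mkmalgUD (m : cmonom nat) (c d : A) :
  mkmalgU m (c + d) = (mkmalgU m c : polyN A) + mkmalgU m d.
Proof. exact: monalgUD. Qed.

Lemma mkmalgU0 (m : cmonom nat) : mkmalgU m (0 : A) = (0 : polyN A).
Proof. exact: monalgU0. Qed.

Lemma polyN_indU (P : polyN A -> Prop) :
  P 0 -> (forall m c, P (mkmalgU m c)) ->
  (forall p q, P p -> P q -> P (p + q)) -> forall p, P p.
Proof.
move=> P0 PU PD p; rewrite (monalgE p).
by apply: (big_ind P P0 PD) => m _; exact: PU.
Qed.

(** Strong induction on the degree splits one variable off a monomial. Identities between morphisms
    or derivations thereby reduce to constants and variables. *)
Lemma polyN_ind (P : polyN A -> Prop) :
  (forall c, P (constN c)) -> (forall i, P (varN A i)) ->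
  (forall p q, P p -> P q -> P (p + q)) ->
  (forall p q, P p -> P q -> P (p * q)) -> forall p, P p.
Proof.
move=> Pc Pv PD PM; apply: polyN_indU; last exact: PD.
  by have := Pc 0; rewrite /constN mkmalgU0.
move=> m c.
have [n] := ubnP (mdeg m); elim: n m => // n IHn m.
have [-> _|] := eqVneq m mone; first exact: Pc.
rewrite -mdeg_eq0 => m0; rewrite ltnS => mn.
have [i im] : exists i, i \in finsupp m.
  apply/fset0Pn; apply: contra m0 => /eqP m0.
  by rewrite mdegE m0 big_seq_fset0.
have mi : m = mulcm (ucm i) (divcm m (ucm i)).
  apply/eqP/cmP => j; rewrite mulcmE divcmE ucmE subnKC //.
  by have [<-|//] := eqVneq i j; rewrite lt0n cmE_neq0.
rewrite mi -[c]mul1r -mkmalgUM; apply: PM; [exact: Pv|apply: IHn].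
by apply: leq_trans mn; rewrite {2}mi mdegM mdegU.
Qed.

Lemma constNM (c d : A) : constN (c * d) = constN c * constN d.
Proof. by rewrite /constN mkmalgUM [mulcm _ _]mul0cm. Qed.

Fact constN_zmod_morphism : zmod_morphism (@constN A).
Proof. exact: monalgUB. Qed.

HB.instance Definition _ := GRing.isZmodMorphism.Build A (polyN A) (@constN A)
  constN_zmod_morphism.

Fact constN_monoid_morphism : monoid_morphism (@constN A).
Proof. by split; [|exact: constNM]. Qed.

HB.instance Definition _ := GRing.isMonoidMorphism.Build A (polyN A) (@constN A)
  constN_monoid_morphism.

Lemma rmorph_substN (B C : comNzRingType) (f : {rmorphism A -> B})
    (g : {rmorphism B -> C}) (h : {rmorphism A -> C}) (v : nat -> B) p :
  g \o f =1 h -> g (substN f v p) = substN h (g \o v) p.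
Proof.
move=> gf; elim/polyN_ind: p => [c|i|p q IHp IHq|p q IHp IHq].
- by rewrite !substN_const -gf.
- by rewrite !substN_var.
- by rewrite !rmorphD IHp IHq.
- by rewrite !rmorphM IHp IHq.
Qed.

Lemma eq_substN (B : comNzRingType) (f : {rmorphism A -> B}) (v w : nat -> B) p :
  (forall i, i < var_bound p -> v i = w i)%N -> substN f v p = substN f w p.
Proof.
move=> vw; rewrite /substN /mmap big_seq [RHS]big_seq.
apply: eq_bigr => m mp; congr (_ * _).
rewrite big_seq [RHS]big_seq; apply: eq_bigr => i im.
by rewrite vw //; apply: var_boundP mp im.
Qed.

End PolyN.

Section OrdinalSums.

Variables (V : nmodType) (F : nat -> V).

Lemma sum_ord_widen m n : (m <= n)%N -> (forall l, (m <= l)%N -> F l = 0) ->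
  \sum_(l < m) F l = \sum_(l < n) F l.
Proof.
move=> mn F0; rewrite -!(big_mkord xpredT F) (big_cat_nat (leq0n _) mn) /=.
by rewrite [X in _ + X]big_nat [X in _ + X]big1 ?addr0 // => l /andP[/F0].
Qed.

Lemma sum_ord_single n k : (k < n)%N -> (forall l, l != k -> F l = 0) ->
  \sum_(l < n) F l = F k.
Proof.
move=> kn F0; rewrite (bigD1 (Ordinal kn)) //= big1 ?addr0 // => l lk.
exact: F0.
Qed.

End OrdinalSums.

Section LeibnizRule.

Variables (P : comNzRingType) (d e : P -> P).
Hypothesis dD : {morph d : p q / p + q}.
Hypothesis eD : {morph e : p q / p + q}.
Implicit Types p q : P.

(** The product rule is stated at one pair of arguments, so that it can be proved by induction on
    either of them. *)
Definition leibniz_at (f : P -> P) p q := f (p * q) = f p * q + p * f q.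

Lemma leibniz_atDl p1 p2 q :
  leibniz_at d p1 q -> leibniz_at d p2 q -> leibniz_at d (p1 + p2) q.
Proof. by rewrite /leibniz_at => e1 e2; rewrite mulrDl !dD e1 e2; ring. Qed.

Lemma leibniz_atDr p q1 q2 :
  leibniz_at d p q1 -> leibniz_at d p q2 -> leibniz_at d p (q1 + q2).
Proof. by rewrite /leibniz_at => e1 e2; rewrite mulrDr !dD e1 e2; ring. Qed.

Lemma leibniz_at0l q : d 0 = 0 -> leibniz_at d 0 q.
Proof. by rewrite /leibniz_at => d0; rewrite !mul0r d0; ring. Qed.

Lemma leibniz_at0r p : d 0 = 0 -> leibniz_at d p 0.
Proof. by rewrite /leibniz_at => d0; rewrite !mulr0 d0; ring. Qed.

Lemma leibniz_sum n (g : 'I_n -> P) (h : 'I_n -> P -> P) p q :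
  leibniz_at d p q -> (forall i, leibniz_at (h i) p q) ->
  leibniz_at (fun r => d r + \sum_(i < n) g i * h i r) p q.
Proof.
rewrite /leibniz_at => dpq hpq; rewrite dpq.
under eq_bigr => i _ do rewrite hpq mulrDr.
rewrite big_split /= mulrDl mulrDr mulr_suml mulr_sumr.
rewrite [X in _ = _ + X + _](eq_bigr (fun i => g i * (h i p * q))); last first.
  by move=> i _; rewrite mulrA.
rewrite [X in _ = _ + (_ + X)](eq_bigr (fun i => g i * (p * h i q))); last first.
  by move=> i _; ring.
by ring.
Qed.

Lemma add_sum_morph n (g : 'I_n -> P) (h : 'I_n -> P -> P) :
  (forall i, {morph h i : p q / p + q}) ->
  {morph (fun r => d r + \sum_(i < n) g i * h i r) : p q / p + q}.
Proof.
move=> hD p q /=; rewrite dD addrACA -big_split /=; congr (_ + _).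
by apply: eq_bigr => i _; rewrite hD mulrDr.
Qed.

(** The commutator of two derivations is a derivation, so an identity [[d, e] = f] passes to
    products. *)
Lemma bracket_leibniz (f : P -> P) p q : (forall p q, leibniz_at d p q) ->
  (forall p q, leibniz_at e p q) -> leibniz_at f p q ->
  d (e p) = e (d p) + f p -> d (e q) = e (d q) + f q ->
  d (e (p * q)) = e (d (p * q)) + f (p * q).
Proof.
move=> dM eM -> dep deq; rewrite (eM p q) (dM p q) dD eD.
by rewrite (dM (e p)) (dM p) (eM (d p)) (eM p) dep deq; ring.
Qed.

Lemma bracketD (f : P -> P) p q : {morph f : p q / p + q} ->
  d (e p) = e (d p) + f p -> d (e q) = e (d q) + f q ->
  d (e (p + q)) = e (d (p + q)) + f (p + q).
Proof. by move=> fD ep eq; rewrite eD !dD eD fD ep eq; ring. Qed.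

End LeibnizRule.

Section Derivations.

Variable R : realType.
Implicit Types p q : polyN R.

Local Notation pd := (@partial_deriv R).
Local Notation td := (@total_deriv_poly R).

Section PartialDerivative.

Variable i : nat.

Let dterm (m : cmonom nat) (c : R) : polyN R :=
  mkmalgU (divcm m (ucm i)) (c *+ m i).

Let dterm0 m : dterm m 0 = 0.
Proof. by rewrite /dterm mul0rn mkmalgU0. Qed.

Let dtermD m c d : dterm m (c + d) = dterm m c + dterm m d.
Proof. by rewrite /dterm mulrnDl mkmalgUD. Qed.

Let partial_derivEw p (d : {fset cmonom nat}) : (msupp p `<=` d)%fset ->
  pd i p = \sum_(m <- d) dterm m (mcoeff m p).
Proof.
move=> pd; rewrite /partial_deriv.
rewrite (big_fset_incl _ pd); first by [].
move=> m _ mp.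
rewrite mcoeff_outdom; last by [].
rewrite mul0rn.
rewrite mkmalgU0.
by [].
Qed.

Lemma partial_derivD p q :
  pd i (p + q) = pd i p + pd i q.
Proof.
rewrite (@partial_derivEw p (msupp p `|` msupp q)%fset) ?fsubsetUl //.
rewrite (@partial_derivEw q (msupp p `|` msupp q)%fset) ?fsubsetUr //.
rewrite (partial_derivEw (msuppD_le p q)) -big_split; apply: eq_bigr => m _.
by rewrite mcoeffD dtermD.
Qed.

Let partial_derivU m c : pd i (mkmalgU m c) = dterm m c.
Proof.
by rewrite (partial_derivEw msuppU_le) big_seq_fset1 mcoeffUU.
Qed.

(** This coefficientwise form shows later that differentiation lowers the degree and that its common
    kernel consists of the constants. *)
Lemma mcoeff_partial_deriv k p :
  mcoeff k (pd i p) = mcoeff (mulcm k (ucm i)) p *+ (k i).+1.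
Proof.
elim/polyN_indU: p => [|m c|p q Hp Hq].
- have -> : pd i 0 = 0.
    exact: etrans (congr1 (pd i) (esym (mkmalgU0 R mone)))
      (etrans (partial_derivU _ _) (dterm0 _)).
  by rewrite !mcoeff0 mul0rn.
- rewrite partial_derivU /dterm !mcoeffU.
  have [->|mk] := eqVneq m (mulcm k (ucm i)).
    have -> : divcm (mulcm k (ucm i)) (ucm i) = k.
      by apply/eqP/cmP => j; rewrite divcmE mulcmE ucmE addnK.
    by rewrite eqxx !mulr1n mulcmE ucmE eqxx addn1.
  rewrite mulr0n mul0rn; case: eqP => [e|_]; last by rewrite mulr0n.
  rewrite mulr1n; case: (posnP (m i)) => [->|mi]; first by rewrite mulr0n.
  case/negP: mk; apply/cmP => j; rewrite mulcmE ucmE -e divcmE ucmE.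
  by have [<-|_] := eqVneq i j; rewrite ?subn0 ?addn0 // subnK.
- pose e := congr1 (fun z => z *+ (k i).+1) (esym (mcoeffD (mulcm k (ucm i)) p q)).
  exact: etrans (congr1 (mcoeff k) (partial_derivD p q)) (etrans (mcoeffD k _ _)
    (etrans (congr2 +%R Hp Hq) (etrans (esym (mulrnDl _ _ _)) e))).
Qed.

Lemma partial_deriv_eq0 p : (var_bound p <= i)%N -> pd i p = 0.
Proof.
move=> pi; rewrite /partial_deriv big_seq; apply: big1 => m mp.
suff -> : m i = 0%N by rewrite mulr0n; exact: mkmalgU0.
apply/eqP; rewrite cmE_eq0; apply/negP => im.
by have := var_boundP mp im; rewrite ltnNge pi.
Qed.

Local Opaque partial_deriv.

Lemma partial_deriv_const c : pd i (constN c) = 0.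
Proof. by rewrite partial_derivU /dterm cm1 mulr0n mkmalgU0. Qed.

Lemma partial_deriv_var j : pd i (varN R j) = (i == j)%:R.
Proof.
rewrite partial_derivU /dterm ucmE eq_sym.
have [->|_] := eqVneq i j; last by rewrite mulr0n mkmalgU0.
rewrite (mulr1n (1 : R)) (mulr1n (1 : polyN R)).
have -> : divcm (ucm j) (ucm j) = onecm nat.
  by apply/eqP/cmP => k; rewrite divcmE subnn onecmE.
exact: (rmorph1 (@constN R)).
Qed.

Let dtermM m1 m2 c1 c2 : dterm (mulcm m1 m2) (c1 * c2) =
  dterm m1 c1 * mkmalgU m2 c2 + mkmalgU m1 c1 * dterm m2 c2.
Proof.
have e1 := @mkmalgUM R (divcm m1 (ucm i)) m2 (c1 *+ m1 i) c2.
have e2 := @mkmalgUM R m1 (divcm m2 (ucm i)) c1 (c2 *+ m2 i).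
rewrite /dterm.
transitivity (mkmalgU (mulcm (divcm m1 (ucm i)) m2) ((c1 *+ m1 i) * c2) +
  mkmalgU (mulcm m1 (divcm m2 (ucm i))) (c1 * (c2 *+ m2 i)) : polyN R); last first.
  by rewrite -e1 -e2.
clear e1 e2.
have eR : (c1 * c2) *+ (mulcm m1 m2) i = (c1 *+ m1 i) * c2 + c1 * (c2 *+ m2 i).
  by rewrite mulcmE mulrnDr mulrnAl mulrnAr.
have E1 : mkmalgU (divcm (mulcm m1 m2) (ucm i)) ((c1 *+ m1 i) * c2) =
    mkmalgU (mulcm (divcm m1 (ucm i)) m2) ((c1 *+ m1 i) * c2) :> polyN R.
  (* Subtraction of exponents truncates at 0, but exactly there the coefficient [c1 *+ m1 i]
     vanishes. *)
  case: (posnP (m1 i)) => [->|m1i]; first by rewrite mulr0n mul0r !mkmalgU0.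
  suff e : divcm (mulcm m1 m2) (ucm i) = mulcm (divcm m1 (ucm i)) m2.
    exact: (congr1 (fun m => mkmalgU m _ : polyN R) e).
  apply/eqP/cmP => j; rewrite divcmE !mulcmE divcmE ucmE.
  by have [<-|_] := eqVneq i j; rewrite ?subn0 // addnBAC.
have E2 : mkmalgU (divcm (mulcm m1 m2) (ucm i)) (c1 * (c2 *+ m2 i)) =
    mkmalgU (mulcm m1 (divcm m2 (ucm i))) (c1 * (c2 *+ m2 i)) :> polyN R.
  clear E1 eR.
  case: (posnP (m2 i)) => [->|m2i]; first by rewrite mulr0n mulr0 !mkmalgU0.
  suff e : divcm (mulcm m1 m2) (ucm i) = mulcm m1 (divcm m2 (ucm i)).
    exact: (congr1 (fun m => mkmalgU m _ : polyN R) e).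
  apply/eqP/cmP => j; rewrite divcmE !mulcmE divcmE ucmE.
  by have [<-|_] := eqVneq i j; rewrite ?subn0 // addnBA.
rewrite eR mkmalgUD E1 E2; exact: erefl.
Qed.

Let partial_deriv0 : pd i 0 = 0.
Proof. by rewrite -(rmorph0 (@constN R)) partial_deriv_const rmorph0. Qed.

Lemma partial_derivM p q : leibniz_at (pd i) p q.
Proof.
elim/polyN_indU: p => [|m1 c1|p1 p2].
- exact: leibniz_at0l.
- elim/polyN_indU: q => [|m2 c2|q1 q2].
  + exact: leibniz_at0r.
  + pose e := congr1 (pd i) (@mkmalgUM R m1 m2 c1 c2).
    pose e' := congr2 (fun a b => a * mkmalgU m2 c2 + mkmalgU m1 c1 * b)
      (esym (partial_derivU m1 c1)) (esym (partial_derivU m2 c2)).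
    exact: etrans e (etrans (partial_derivU _ _) (etrans (dtermM _ _ _ _) e')).
  + exact: (leibniz_atDr partial_derivD).
- exact: (leibniz_atDl partial_derivD).
Qed.

End PartialDerivative.

Lemma partial_deriv0 i : pd i 0 = 0.
Proof. by rewrite -(rmorph0 (@constN R)) partial_deriv_const rmorph0. Qed.

Lemma partial_deriv_bool i (b : bool) : pd i b%:R = 0.
Proof.
case: b; last exact: partial_deriv0.
by rewrite -(rmorph1 (@constN R)) partial_deriv_const.
Qed.

(** The cut-off in [total_deriv_poly] varies with the polynomial. A common larger one makes the
    expressions for [p], [q], [p + q] and [p * q] comparable. *)
Lemma total_deriv_polyE p n : (var_bound p <= n)%N ->
  td p = pd 0 p +
    \sum_(l < n) varN R l.+2 * pd l.+1 p.
Proof.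
move=> pn; rewrite /total_deriv_poly.
rewrite (sum_ord_widen (F := fun l => varN R l.+2 * pd l.+1 p) pn); first by [].
by move=> l pl; rewrite partial_deriv_eq0 ?mulr0 // leqW.
Qed.

Lemma total_deriv_poly_const c : td (constN c) = 0.
Proof.
rewrite /total_deriv_poly partial_deriv_const add0r; apply: big1 => l _.
by rewrite partial_deriv_const mulr0.
Qed.

Lemma total_deriv_poly_var i :
  td (varN R i) = if i is l.+1 then varN R l.+2 else 1.
Proof.
pose n := maxn (var_bound (varN R i)) i.
rewrite (@total_deriv_polyE _ n) ?leq_maxl // partial_deriv_var.
case: i @n => [|i] n.
  rewrite big1 ?addr0 // => l _.
  by rewrite partial_deriv_var mulr0.
have lt_in : (i < n)%N by rewrite leq_max leqnn orbT.
rewrite (sum_ord_single (F := fun l => varN R l.+2 * pd l.+1 (varN R i.+1)) lt_in).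
  by rewrite partial_deriv_var eqxx mulr1 add0r.
by move=> l li; rewrite partial_deriv_var eqSS (negPf li) mulr0.
Qed.

Local Opaque total_deriv_poly.

Lemma total_deriv_polyD p q : td (p + q) = td p + td q.
Proof.
pose n := maxn (var_bound (p + q)) (maxn (var_bound p) (var_bound q)).
rewrite (@total_deriv_polyE (p + q) n) ?leq_max ?leqnn ?orbT //.
rewrite (@total_deriv_polyE p n) ?leq_max ?leqnn ?orbT //.
rewrite (@total_deriv_polyE q n) ?leq_max ?leqnn ?orbT //.
exact: (add_sum_morph (@partial_derivD 0) _ (fun i => @partial_derivD i.+1)).
Qed.

Lemma total_deriv_polyM p q : leibniz_at td p q.
Proof.
pose n := maxn (var_bound (p * q)) (maxn (var_bound p) (var_bound q)).
rewrite /leibniz_at.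
rewrite (@total_deriv_polyE (p * q) n) ?leq_max ?leqnn ?orbT //.
rewrite (@total_deriv_polyE p n) ?leq_max ?leqnn ?orbT //.
rewrite (@total_deriv_polyE q n) ?leq_max ?leqnn ?orbT //.
exact: (leibniz_sum _ (partial_derivM 0 p q) (fun i => partial_derivM i.+1 p q)).
Qed.

Lemma total_deriv_poly0 : td 0 = 0.
Proof. by rewrite -(rmorph0 (@constN R)) total_deriv_poly_const rmorph0. Qed.

Lemma total_deriv_poly_bool (b : bool) : td b%:R = 0.
Proof.
case: b; last exact: total_deriv_poly0.
by rewrite -(rmorph1 (@constN R)) total_deriv_poly_const.
Qed.

(** The variable [i.+2] is y_(i+1), so this is [[d/dy_(i+1), D_x] = d/dy_i]. Both sides being
    derivations in [p] modulo the bracket, it suffices to check the variables, on which [D_x] is a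
    shift. *)
Lemma partial_total_derivC i p : pd i.+2 (td p) = td (pd i.+2 p) + pd i.+1 p.
Proof.
elim/polyN_ind: p => [c|k|p q|p q].
- by rewrite total_deriv_poly_const !partial_deriv_const partial_deriv0
    total_deriv_poly0 addr0.
- rewrite total_deriv_poly_var !partial_deriv_var total_deriv_poly_bool add0r.
  case: k => [|k]; last by rewrite partial_deriv_var eqSS.
  exact: (partial_deriv_bool _ true).
- exact: (@bracketD (polyN R) (pd i.+2) td (@partial_derivD i.+2)
    total_deriv_polyD (pd i.+1) p q (@partial_derivD i.+1)).
- apply: (@bracket_leibniz (polyN R) (pd i.+2) td (@partial_derivD i.+2)
    total_deriv_polyD (pd i.+1) p q).
  + exact: partial_derivM.
  + exact: total_deriv_polyM.
  + exact: partial_derivM.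
Qed.

End Derivations.

Local Opaque partial_deriv total_deriv_poly.

(** * Evaluation of polynomials at finite jets *)

Section Fractions.

Lemma frac_repr (D : idomainType) (F : {fraction D}) :
  tofrac \d_(repr F) != 0 /\ F = tofrac \n_(repr F) / tofrac \d_(repr F).
Proof.
have d0 : tofrac \d_(repr F) != 0 by rewrite tofrac_eq0 denom_ratioP.
split=> //; apply/(canRL (mulfK d0)).
rewrite -{1}[F]reprK; unlock FracField.tofrac; rewrite -[LHS]FracField.pi_mul.
apply/eqmodP; rewrite /= FracField.equivfE /FracField.mulf.
by rewrite !numden_Ratio ?mulf_neq0 ?denom_ratioP ?oner_neq0 // !mulr1 mulrC.
Qed.

Variable R : realType.
Implicit Types (p q : polyN R) (F G : jetfun R).

Fact to_jetfun_zmod_morphism : zmod_morphism (@to_jetfun R).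
Proof. exact: tofracB. Qed.

HB.instance Definition _ := GRing.isZmodMorphism.Build (polyN R) (jetfun R)
  (@to_jetfun R) to_jetfun_zmod_morphism.

Fact to_jetfun_monoid_morphism : monoid_morphism (@to_jetfun R).
Proof. by split; [exact: tofrac1|exact: tofracM]. Qed.

HB.instance Definition _ := GRing.isMonoidMorphism.Build (polyN R) (jetfun R)
  (@to_jetfun R) to_jetfun_monoid_morphism.

Lemma to_jetfun_eq0 p : (to_jetfun p == 0) = (p == 0).
Proof. exact: tofrac_eq0. Qed.

Lemma jetfun_repr F : let r : {ratio polyN R} := repr F in
  to_jetfun \d_r != 0 /\ F = to_jetfun \n_r / to_jetfun \d_r.
Proof. exact: frac_repr. Qed.

End Fractions.

Section Evaluation.

Variable R : realType.
Implicit Types (p q : polyN R) (u v : nat -> R).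

Definition ev u : polyN R -> R := substN idfun u.

HB.instance Definition _ u := GRing.RMorphism.on (ev u).

Lemma ev_const u c : ev u (constN c) = c.
Proof. exact: substN_const. Qed.

Lemma ev_var u i : ev u (varN R i) = u i.
Proof. exact: substN_var. Qed.

Lemma eq_ev u v p : (forall i, i < var_bound p -> u i = v i)%N -> ev u p = ev v p.
Proof. exact: eq_substN. Qed.

(** The restriction of a polynomial on jet space to the polynomial curve [t |-> v(t)]. It reduces
    nonvanishing questions to one variable. *)
Definition along (v : nat -> {poly R}) : polyN R -> {poly R} :=
  substN (@polyC R) v.

HB.instance Definition _ (v : nat -> {poly R}) := GRing.RMorphism.on (along v).

Lemma horner_along (v : nat -> {poly R}) p t : (along v p).[t] = ev (fun i => (v i).[t]) p.
Proof.
apply: (@rmorph_substN _ _ _ polyC (horner_eval t) idfun) => c /=.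
by rewrite /horner_eval hornerC.
Qed.

(** An injective sequence offers more points than [P] has roots. *)
Lemma horner_neq0_exists (P : {poly R}) (s : nat -> R) : P != 0 -> injective s ->
  exists n, P.[s n] != 0.
Proof.
move=> P0 injs; apply/notP => noex.
have roots n : P.[s n] = 0.
  by apply/eqP/negPn/negP => Pn; apply: noex; exists n.
pose r := [seq s n | n <- iota 0 (size P)].
have rP : all (root P) r by apply/allP => x /mapP[n _ ->]; rewrite rootE roots.
have ur : uniq r by rewrite (map_inj_uniq injs) iota_uniq.
by have := max_poly_roots P0 rP ur; rewrite size_map size_iota ltnn.
Qed.

(** Digits in base [N] are recovered by reducing modulo [N] and dividing by [N]. *)
Lemma base_expansion_inj N n (a b : nat -> nat) :
  (forall i, i < n -> a i < N)%N -> (forall i, i < n -> b i < N)%N ->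
  (\sum_(i < n) a i * N ^ i = \sum_(i < n) b i * N ^ i)%N ->
  forall i, (i < n)%N -> a i = b i.
Proof.
elim: n a b => [//|n IHn] a b aN bN.
have N0 : (0 < N)%N by apply: leq_trans (aN 0%N isT).
have step (c : nat -> nat) : (\sum_(i < n.+1) c i * N ^ i =
    (\sum_(i < n) c i.+1 * N ^ i) * N + c 0)%N.
  rewrite big_ord_recl expn0 muln1 addnC big_distrl; congr (_ + _)%N.
  by apply: eq_bigr => i _; rewrite lift0 expnSr mulnA.
rewrite !step => e.
have e0 : a 0%N = b 0%N.
  by have := congr1 (modn^~ N) e; rewrite !modnMDl !modn_small ?aN ?bN.
have eS : (\sum_(i < n) a i.+1 * N ^ i = \sum_(i < n) b i.+1 * N ^ i)%N.
  have := congr1 (divn^~ N) e.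
  by rewrite !divnMDl // !divn_small ?aN ?bN // !addn0.
by case=> [|i] // ni; apply: (IHn (a \o succn) (b \o succn)) => // j jn;
  [exact: aN|exact: bN].
Qed.

Lemma sum_finsupp_ord (F : nat -> nat) (s : {fset nat}) n :
  (forall i, i \in s -> i < n)%N -> (forall i, i \notin s -> F i = 0)%N ->
  (\sum_(i <- s) F i = \sum_(i < n) F i)%N.
Proof.
move=> sn s0; rewrite -(big_mkord xpredT F) /index_iota subn0.
rewrite [RHS](bigID (mem s)) /= [X in (_ + X)%N]big1 ?addn0; last first.
  by move=> i /s0.
rewrite -[RHS]big_filter; apply: perm_big; apply: uniq_perm.
- exact: fset_uniq.
- by rewrite filter_uniq // iota_uniq.
move=> i; rewrite mem_filter mem_iota /= add0n.
by case: (boolP (i \in s)) => [/sn ->|]; rewrite ?andbF.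
Qed.

(* Kronecker substitution: if N exceeds all exponents of p, the monomials of p *)
(* become distinct powers of 'X under x_i |-> 'X^(N^i).                        *)
Lemma ev_neq0_exists p : p != 0 ->
  exists2 u, ev u p != 0 & exists n, forall i, (n <= i)%N -> u i = 0.
Proof.
move=> p0; pose n := var_bound p.
pose N := (\max_(m <- msupp p) \max_(i <- finsupp m) (m i).+1).+1%N.
pose w (m : cmonom nat) := (\sum_(i < n) m i * N ^ i)%N.
have mN m i : m \in msupp p -> (m i < N)%N.
  move=> mp; have [im|] := boolP (i \in finsupp m); last first.
    by rewrite -cmE_eq0 => /eqP ->.
  rewrite ltnS; apply: leq_trans (leq_bigmax_seq _ mp isT).
  apply: ltnW; exact: (leq_bigmax_seq _ im isT).
have winj m1 m2 : m1 \in msupp p -> m2 \in msupp p -> w m1 = w m2 -> m1 = m2.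
  move=> m1p m2p e; apply/eqP/cmP => i.
  have [ni|ni] := ltnP i n.
    by apply: (base_expansion_inj _ _ e ni) => j _; apply: mN.
  suff z m : m \in msupp p -> m i = 0%N by rewrite !z.
  move=> mp; apply/eqP; rewrite cmE_eq0; apply/negP => im.
  by have := var_boundP mp im; rewrite ltnNge ni.
pose P := along (fun i => 'X^(N ^ i)) p.
have P0 : P != 0.
  have [m mp] : exists m, m \in msupp p.
    by apply/fset0Pn; rewrite msupp_eq0.
  apply/eqP => /(congr1 (coefp (w m))); rewrite /= coef0 /P /along /substN mmapE.
  have wE k : k \in msupp p -> mon_subst (fun i => 'X^(N ^ i) : {poly R}) k = 'X^(w k).
    move=> kp; rewrite /mon_subst /w -(@sum_finsupp_ord (fun i => (k i * N ^ i)%N) (finsupp k)).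
    - rewrite -prodrXr; apply: eq_bigr => i _.
      by rewrite -exprM mulnC.
    - by move=> i ik; apply: var_boundP kp ik.
    - by move=> i; rewrite -cmE_eq0 => /eqP ->.
  rewrite (eq_big_seq (fun k => (mcoeff k p)%:P * 'X^(w k))); last first.
    by move=> k kp /=; rewrite -wE.
  rewrite coef_sum (big_fsetD1 m) //= coefCM coefXn eqxx mulr1.
  rewrite big_seq big1 ?addr0 => [/eqP|k].
    by rewrite (monalg.mcoeff_eq0 p) mp.
  rewrite in_fsetD1 => /andP[km kp]; rewrite coefCM coefXn.
  case: eqP => [e|]; last by rewrite mulr0.
  by rewrite (winj _ _ mp kp e) eqxx in km.
have natinj : injective (fun k => k%:R : R).
  by move=> i j /eqP; rewrite eqr_nat => /eqP.
have [k Pk] := horner_neq0_exists P0 natinj.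
(* Coordinates beyond the variables of [p] do not affect its value; zero makes [u] a finite jet. *)
pose u i : R := if (i < n)%N then k%:R ^+ (N ^ i) else 0.
exists u; last by exists n => i ni; rewrite /u ltnNge ni.
move: Pk; rewrite horner_along; congr (_ != 0); apply: eq_ev => i ni.
by rewrite /u ni !hornerE.
Qed.

(* Move from b towards a point where p is nonzero: along this line p is a nonzero *)
(* univariate polynomial, and M stays positive near b.                            *)
Lemma ev_neq0_near (M p : polyN R) b : p != 0 -> 0 < ev b M ->
  (exists n, forall i, (n <= i)%N -> b i = 0) ->
  exists u, [/\ ev u p != 0, 0 < ev u M & exists n, forall i, (n <= i)%N -> u i = 0].
Proof.
move=> p0 Mb [n1 b0]; have [d pd [n2 d0]] := ev_neq0_exists p0.
pose l i := (b i)%:P + 'X * (d i - b i)%:P.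
have le t : (fun i => (l i).[t]) = (fun i => b i + t * (d i - b i)).
  by apply/funext => i; rewrite /l !hornerE.
have P0 : along l p != 0.
  apply: contraNneq pd => P0; have := horner_along l p 1.
  rewrite P0 horner0 le => /esym/eqP; congr (_ == 0); congr (ev _ p).
  by apply/funext => i; rewrite mul1r addrC subrK.
have [e e0 Me] : exists2 e : R, 0 < e & forall t, `|t| < e -> 0 < (along l M).[t].
  have M0 : 0 < (along l M).[0].
    rewrite horner_along le; congr (0 < _): Mb; congr (ev _ M).
    by apply/funext => i; rewrite mul0r addr0.
  have [e /= e0 Me] : \forall t \near (0 : R), 0 < (along l M).[t].
    exact: (cvgr_gt _ (@continuous_horner _ (along l M) 0) _ M0).
  by exists e => // t te; apply: Me; rewrite /= sub0r normrN.
(* The points [e / (k + 2)] are infinitely many and lie strictly within [e] of 0, where [M] stays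
   positive. *)
have inj : injective (fun k => e / k.+2%:R).
  move=> i j /(mulfI (lt0r_neq0 e0)) /invr_inj /eqP.
  by rewrite eqr_nat => /eqP[].
have [k Pk] := horner_neq0_exists P0 inj.
exists (fun i => (l i).[e / k.+2%:R]); split.
- by rewrite -horner_along.
- rewrite -horner_along; apply: Me.
  rewrite gtr0_norm ?divr_gt0 // ltr_pdivrMr // ltr_pMr //.
  by rewrite ltr1n.
- exists (maxn n1 n2) => i; rewrite geq_max => /andP[n1i n2i].
  by rewrite /l b0 // d0 // subrr hornerD hornerM !hornerC mulr0 addr0.
Qed.

End Evaluation.

(** * Values of rational functions on jet space *)

Section FractionRules.

Variables (P : idomainType) (K : fieldType) (t : {rmorphism P -> K}).
Hypothesis t_eq0 : forall p, (t p == 0) = (p == 0).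
Implicit Types p q r s : P.

Lemma rfrac_eq p q r s : q != 0 -> s != 0 ->
  (t p / t q == t r / t s) = (p * s - r * q == 0).
Proof.
move=> q0 s0; rewrite eqr_div ?t_eq0 // -subr_eq0.
by rewrite -t_eq0 rmorphB !rmorphM.
Qed.

Lemma rfracD p q r s : q != 0 -> s != 0 ->
  t p / t q + t r / t s = t (p * s + r * q) / t (q * s).
Proof. by move=> q0 s0; rewrite addf_div ?t_eq0 // rmorphD !rmorphM. Qed.

Lemma rfracM p q r s : t p / t q * (t r / t s) = t (p * r) / t (q * s).
Proof. by rewrite !rmorphM invfM mulrACA. Qed.

Lemma rfracN p q : - (t p / t q) = t (- p) / t q.
Proof. by rewrite rmorphN mulNr. Qed.

Variables (L : fieldType) (e : {rmorphism P -> L}).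

Lemma rfrac_unique p q r s : e q != 0 -> e s != 0 -> p * s - r * q = 0 ->
  e p / e q = e r / e s.
Proof.
move=> q0 s0 pq; apply/eqP; rewrite eqr_div // -subr_eq0 -!rmorphM -rmorphB.
by rewrite pq rmorph0.
Qed.

Lemma ev_fracD p q r s : e q != 0 -> e s != 0 ->
  e p / e q + e r / e s = e (p * s + r * q) / e (q * s).
Proof. by move=> q0 s0; rewrite addf_div // rmorphD !rmorphM. Qed.

Lemma ev_fracM p q r s : e p / e q * (e r / e s) = e (p * r) / e (q * s).
Proof. by rewrite !rmorphM invfM mulrACA. Qed.

Lemma ev_fracN p q : - (e p / e q) = e (- p) / e q.
Proof. by rewrite rmorphN mulNr. Qed.

Lemma ev_mul_neq0 p q : (e (p * q) != 0) = (e p != 0) && (e q != 0).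
Proof. by rewrite rmorphM mulf_eq0 negb_or. Qed.

Lemma ev_frac_eq p q r s : e q != 0 -> e s != 0 -> e p / e q = e r / e s ->
  e (p * s - r * q) = 0.
Proof.
move=> q0 s0 /eqP; rewrite eqr_div // => /eqP e0.
by rewrite rmorphB !rmorphM e0 subrr.
Qed.

End FractionRules.

Section Values.

Variable R : realType.
Implicit Types (p q : polyN R) (F G : jetfun R) (u v : nat -> R).

Local Notation tj := (@to_jetfun R).

Lemma ev_neq0 u q : ev u q != 0 -> q != 0.
Proof. by apply: contraNneq => ->; rewrite rmorph0. Qed.

Lemma tj_neq0 q : q != 0 -> tj q != 0.
Proof. by rewrite to_jetfun_eq0. Qed.

Lemma jetfun_div F : exists p q, q != 0 /\ F = tj p / tj q.
Proof.
have /= [d0 e] := jetfun_repr F; exists (\n_(repr F)), (\d_(repr F)).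
by split; [move: d0; rewrite to_jetfun_eq0|exact: e].
Qed.

Lemma tj_div_eq p q r s : q != 0 -> s != 0 ->
  (tj p / tj q == tj r / tj s) = (p * s - r * q == 0).
Proof. exact: (rfrac_eq (@to_jetfun_eq0 R)). Qed.

Lemma value_frac p q u : ev u q != 0 ->
  has_value (tj p / tj q) u (ev u p / ev u q).
Proof. by move=> q0; exists p, q. Qed.

Lemma has_valueP F u c : has_value F u c -> exists p q,
  [/\ F = tj p / tj q, ev u q != 0 & c = ev u p / ev u q].
Proof. by []. Qed.

(** Two representations of [F] regular at [u] satisfy a cross-multiplied identity of polynomials,
    which can be evaluated at [u]. *)
Lemma value_unique F u b c : has_value F u b -> has_value F u c -> b = c.
Proof.
move=> /has_valueP[p [q [-> q0 ->]]] /has_valueP[r [s [e s0 ->]]].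
apply: (rfrac_unique (e := ev u)) => //; apply/eqP.
by rewrite -tj_div_eq ?(ev_neq0 q0) ?(ev_neq0 s0) // e.
Qed.

Lemma value_poly p u : has_value (tj p) u (ev u p).
Proof.
have := @value_frac p 1 u; rewrite !rmorph1 !divr1; apply.
exact: oner_neq0.
Qed.

Lemma value_var i u : has_value (tj (varN R i)) u (u i).
Proof. by have := value_poly (varN R i) u; rewrite ev_var. Qed.

Lemma value_const c u : has_value (tj (constN c)) u c.
Proof. by have := value_poly (constN c) u; rewrite ev_const. Qed.

Lemma value1 u : has_value (1 : jetfun R) u 1.
Proof. by have := value_poly 1 u; rewrite !rmorph1. Qed.

Lemma value0 u : has_value (0 : jetfun R) u 0.
Proof. by have := value_poly 0 u; rewrite !rmorph0. Qed.

Lemma valueD F G u b c :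
  has_value F u b -> has_value G u c -> has_value (F + G) u (b + c).
Proof.
move=> /has_valueP[p [q [-> q0 ->]]] /has_valueP[r [s [-> s0 ->]]].
exists (p * s + r * q), (q * s); split.
- exact: (rfracD (@to_jetfun_eq0 R) _ _ (ev_neq0 q0) (ev_neq0 s0)).
- by rewrite (ev_mul_neq0 (ev u)) q0.
- exact: (ev_fracD (e := ev u)).
Qed.

Lemma valueM F G u b c :
  has_value F u b -> has_value G u c -> has_value (F * G) u (b * c).
Proof.
move=> /has_valueP[p [q [-> q0 ->]]] /has_valueP[r [s [-> s0 ->]]].
exists (p * r), (q * s); split.
- exact: (rfracM (@to_jetfun R)).
- by rewrite (ev_mul_neq0 (ev u)) q0.
- exact: (ev_fracM (ev u)).
Qed.

Lemma valueN F u b : has_value F u b -> has_value (- F) u (- b).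
Proof.
move=> /has_valueP[p [q [-> q0 ->]]]; exists (- p), q; split; first exact: (rfracN (@to_jetfun R)).
- exact: q0.
- exact: (ev_fracN (ev u)).
Qed.

Lemma valueB F G u b c :
  has_value F u b -> has_value G u c -> has_value (F - G) u (b - c).
Proof. by move=> Fb Gc; apply: valueD => //; exact: valueN. Qed.

Lemma valueV F u b : has_value F u b -> b != 0 -> has_value F^-1 u b^-1.
Proof.
move=> /has_valueP[p [q [-> q0 ->]]] b0; exists q, p; split.
- by rewrite invf_div.
- by move: b0; rewrite mulf_eq0 negb_or => /andP[].
- by rewrite -!/(ev u _) invf_div.
Qed.

Lemma value_div F G u b c :
  has_value F u b -> has_value G u c -> c != 0 -> has_value (F / G) u (b / c).
Proof. by move=> Fb Gc c0; apply: valueM => //; exact: valueV. Qed.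

Lemma valueX F u b n : has_value F u b -> has_value (F ^+ n) u (b ^+ n).
Proof.
move=> Fb; elim: n => [|n IHn]; first exact: value1.
by rewrite !exprS; exact: valueM.
Qed.

Lemma value_neq0 F u c : has_value F u c -> c != 0 -> F != 0.
Proof.
move=> Fc; apply: contraNneq => F0; rewrite F0 in Fc.
by apply/eqP; exact: value_unique Fc (value0 u).
Qed.

Definition finite_jet u := exists n, forall i, (n <= i)%N -> u i = 0.

(** If [F] and [G] differed, their cross difference times [N] and both denominators would be nonzero
    at some finite jet with [M] positive, where the two values agree. [M] describes the open set on
    which a comparison is possible, [N] the exceptional set to be avoided. *)
Lemma value_density (M N : polyN R) b F G : finite_jet b -> 0 < ev b M -> N != 0 ->
  (forall u, finite_jet u -> 0 < ev u M -> ev u N != 0 ->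
     exists2 c, has_value F u c & has_value G u c) -> F = G.
Proof.
move=> bfin Mb N0 FG.
have [p [q [q0 eF]]] := jetfun_div F; have [r [s [s0 eG]]] := jetfun_div G.
apply/eqP; rewrite eF eG tj_div_eq //; apply: contrapT => /negP prqs.
have all0 : (p * s - r * q) * (N * (q * s)) != 0.
  by apply: mulf_neq0; [exact: prqs|do 2?[apply: mulf_neq0 => //]].
have [u [u0 Mu ufin]] := ev_neq0_near all0 Mb bfin.
move: u0; rewrite !(ev_mul_neq0 (ev u)) => /and4P[d0 Nu qu su].
have [c Fc Gc] := FG u ufin Mu Nu.
have e1 : c = ev u p / ev u q.
  by apply: value_unique Fc _; rewrite eF; exact: value_frac.
have e2 : c = ev u r / ev u s.
  by apply: value_unique Gc _; rewrite eG; exact: value_frac.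
by case/eqP: d0; apply: (ev_frac_eq (e := ev u)); rewrite // -e1 -e2.
Qed.

Lemma finite_jet0 : finite_jet (fun=> 0).
Proof. by exists 0%N. Qed.

Lemma value_density1 (N : polyN R) F G : N != 0 ->
  (forall u, finite_jet u -> ev u N != 0 ->
     exists2 c, has_value F u c & has_value G u c) -> F = G.
Proof.
move=> N0 FG; apply: (@value_density 1 N (fun=> 0)) N0 _.
- exact: finite_jet0.
- by rewrite rmorph1 ltr01.
- by move=> u ufin _; exact: FG.
Qed.

End Values.

(** * Derivations of the field of jet functions *)

Section QuotientRule.

Variables (P : idomainType) (K : fieldType) (t : {rmorphism P -> K}).
Hypothesis t_eq0 : forall p, (t p == 0) = (p == 0).
Variable d : P -> P.
Hypothesis dD : {morph d : p q / p + q}.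
Hypothesis dM : forall p q, leibniz_at d p q.
Implicit Types p q r s : P.

Definition quot_rule p q := t (d p * q - p * d q) / t (q ^+ 2).

(** Differentiating [p * s = r * q] shows that the quotient rule does not depend on the fraction.
    [total_deriv] is computed on a chosen representative, so this is what makes it usable on any
    other. *)
Lemma quot_rule_eq p q r s : q != 0 -> s != 0 -> t p / t q = t r / t s ->
  quot_rule p q = quot_rule r s.
Proof.
move=> q0 s0 /eqP; rewrite rfrac_eq // subr_eq0 => /eqP e.
have de : d p * s + p * d s = d r * q + r * d q by rewrite -!dM e.
apply/eqP; rewrite rfrac_eq ?expf_neq0 // subr_eq0; apply/eqP.
have -> : (d p * q - p * d q) * s ^+ 2 =
    q * s * (d p * s + p * d s) - (p * s) * (q * d s + s * d q) by ring.
rewrite de e; ring.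
Qed.

Lemma quot_ruleD p q r s : q != 0 -> s != 0 ->
  quot_rule (p * s + r * q) (q * s) = quot_rule p q + quot_rule r s.
Proof.
move=> q0 s0; rewrite /quot_rule rfracD ?expf_neq0 //.
apply/eqP; rewrite rfrac_eq ?expf_neq0 ?mulf_neq0 ?expf_neq0 //.
rewrite dD !dM; apply/eqP; ring.
Qed.

Lemma quot_ruleM p q r s : q != 0 -> s != 0 ->
  quot_rule (p * r) (q * s) =
  quot_rule p q * (t r / t s) + t p / t q * quot_rule r s.
Proof.
move=> q0 s0; rewrite /quot_rule !rfracM rfracD ?mulf_neq0 ?expf_neq0 //.
apply/eqP; rewrite rfrac_eq ?expf_neq0 ?mulf_neq0 ?expf_neq0 //.
rewrite !dM; apply/eqP; ring.
Qed.

Lemma quot_rule1 p : d 1 = 0 -> quot_rule p 1 = t (d p).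
Proof. by move=> d1; rewrite /quot_rule d1 mulr1 mulr0 subr0 expr1n rmorph1 divr1. Qed.

Lemma leibniz1 : d 1 = 0.
Proof.
have := dM 1 1; rewrite /leibniz_at !mul1r mulr1 => /eqP.
by rewrite -subr_eq0 opprD addNKr oppr_eq0 => /eqP.
Qed.

End QuotientRule.

Section FieldDerivations.

Variables (K : fieldType) (d e f : K -> K).
Hypothesis dD : {morph d : p q / p + q}.
Hypothesis dM : forall p q, leibniz_at d p q.
Implicit Types a b : K.

Lemma derivation1 : d 1 = 0.
Proof.
have := dM 1 1; rewrite /leibniz_at !mul1r mulr1 => /eqP.
by rewrite -subr_eq0 opprD addNKr oppr_eq0 => /eqP.
Qed.

Lemma derivation0 : d 0 = 0.
Proof. by have /eqP := dD 0 0; rewrite addr0 -subr_eq0 opprD addNKr oppr_eq0 => /eqP. Qed.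

Lemma derivationN a : d (- a) = - d a.
Proof. by apply/eqP; rewrite -addr_eq0 -dD addNr derivation0. Qed.

Lemma derivationB a b : d (a - b) = d a - d b.
Proof. by rewrite dD derivationN. Qed.

Lemma derivationV a : a != 0 -> d a^-1 = - d a / a ^+ 2.
Proof.
move=> a0; have := dM a a^-1; rewrite /leibniz_at mulfV // derivation1 => h.
apply: (mulfI a0); apply/eqP; rewrite -subr_eq0; apply/eqP.
transitivity (d a / a + a * d a^-1); last by rewrite -h.
by field.
Qed.

Lemma derivation_div a b : b != 0 -> d (a / b) = (d a * b - a * d b) / b ^+ 2.
Proof. by move=> b0; rewrite dM derivationV //; field. Qed.

Lemma derivationXS a n : d (a ^+ n.+1) = n.+1%:R * a ^+ n * d a.
Proof.
elim: n => [|n IHn]; first by rewrite expr1 expr0 !mul1r.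
by rewrite exprS dM IHn exprS -[n.+2%:R]natr1; ring.
Qed.

End FieldDerivations.

Section Brackets.

Variables (K : fieldType) (d e f : K -> K).
Hypothesis dD : {morph d : p q / p + q}.
Hypothesis dM : forall p q, leibniz_at d p q.
Hypothesis eD : {morph e : p q / p + q}.
Hypothesis eM : forall p q, leibniz_at e p q.
Hypothesis fM : forall p q, leibniz_at f p q.
Implicit Types a b : K.

Definition bracket_at a := d (e a) = e (d a) + f a.

Lemma bracket_atM a b : bracket_at a -> bracket_at b -> bracket_at (a * b).
Proof. by move=> ea eb; exact: (bracket_leibniz dD eD dM eM (fM a b)). Qed.

(** Both derivations are applied to [a * a^-1 = 1] in either order. In the difference the mixed
    first-order terms cancel and [a] times the bracket identity at [a^-1] remains. *)
Lemma bracket_atV a : a != 0 -> bracket_at a -> bracket_at a^-1.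
Proof.
move=> a0 ea; rewrite /bracket_at.
have eX := eM a a^-1; have dX := dM a a^-1; have fX := fM a a^-1.
rewrite /leibniz_at mulfV // (derivation1 dM) in dX.
rewrite /leibniz_at mulfV // (derivation1 eM) in eX.
rewrite /leibniz_at mulfV // (derivation1 fM) in fX.
move: (congr1 d eX) (congr1 e dX); rewrite eD dD !eM !dM ea.
rewrite (derivation0 dD) (derivation0 eD); move: a^-1 fX => b fX h1 h2 {dX eX ea}.
apply: (mulfI a0); apply/eqP; rewrite -subr_eq0; apply/eqP.
set X := RHS in h1; set Y := RHS in h2; set Z := RHS in fX.
by transitivity (X - Y - Z); [rewrite /X /Y /Z; ring|rewrite -h1 -h2 -fX !subr0].
Qed.

End Brackets.

Section PhiDerivation.

Variables (K : fieldType) (D : K -> K) (phi : {rmorphism K -> K}) (W : K).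
Hypothesis DD : {morph D : p q / p + q}.
Hypothesis DM : forall p q, leibniz_at D p q.
Implicit Types a b : K.

(** The chain rule for a change of coordinates [phi]: [W] will be the total derivative of the new
    abscissa. *)
Definition chain_at a := D (phi a) = W * phi (D a).

Lemma chain_atD a b : chain_at a -> chain_at b -> chain_at (a + b).
Proof. by rewrite /chain_at => ea eb; rewrite rmorphD !DD ea eb rmorphD mulrDr. Qed.

Lemma chain_atM a b : chain_at a -> chain_at b -> chain_at (a * b).
Proof.
rewrite /chain_at => ea eb.
by rewrite rmorphM (DM a) (DM (phi a)) ea eb rmorphD !rmorphM; ring.
Qed.

Lemma chain_atV a : a != 0 -> chain_at a -> chain_at a^-1.
Proof.
rewrite /chain_at => a0 ea.
rewrite fmorphV (derivationV DM) ?fmorph_eq0 // (derivationV DM a0) ea.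
by rewrite rmorphM rmorphN fmorphV rmorphXn /=; ring.
Qed.

End PhiDerivation.

Section JetDerivations.

Variable R : realType.
Implicit Types (p q : polyN R) (F G : jetfun R).

Local Notation tj := (@to_jetfun R).

Lemma jetfun_ind (Q : jetfun R -> Prop) :
  (forall c, Q (tj (constN c))) -> (forall i, Q (tj (varN R i))) ->
  (forall F G, Q F -> Q G -> Q (F + G)) ->
  (forall F G, Q F -> Q G -> Q (F * G)) ->
  (forall F, F != 0 -> Q F -> Q F^-1) -> forall F, Q F.
Proof.
move=> Qc Qv QD QM QV F.
have Qp p : Q (tj p).
  elim/polyN_ind: p => // p q Qp Qq.
    by rewrite (rmorphD tj); apply: QD.
  by rewrite (rmorphM tj); apply: QM.
have [p [q [q0 ->]]] := jetfun_div F.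
by apply: QM => //; apply: QV => //; exact: tj_neq0.
Qed.

Definition jet_deriv (d : polyN R -> polyN R) (F : jetfun R) : jetfun R :=
  let r : {ratio polyN R} := repr F in quot_rule tj d \n_r \d_r.

Lemma total_derivE : @total_deriv R = jet_deriv (@total_deriv_poly R).
Proof. by []. Qed.

Section OneDerivation.

Variable d : polyN R -> polyN R.
Hypothesis dD : {morph d : p q / p + q}.
Hypothesis dM : forall p q, leibniz_at d p q.

Lemma jet_deriv_frac p q : q != 0 ->
  jet_deriv d (tj p / tj q) = quot_rule tj d p q.
Proof.
move=> q0; have /= [s0 e] := jetfun_repr (tj p / tj q).
rewrite to_jetfun_eq0 in s0.
exact: (quot_rule_eq (@to_jetfun_eq0 R) dM s0 q0 (esym e)).
Qed.

Lemma jet_derivD : {morph jet_deriv d : F G / F + G}.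
Proof.
move=> F G; have [p [q [q0 ->]]] := jetfun_div F.
have [r [s [s0 ->]]] := jetfun_div G.
have e := rfracD (@to_jetfun_eq0 R) p r q0 s0.
rewrite (jet_deriv_frac p q0) (jet_deriv_frac r s0).
apply: etrans (congr1 (jet_deriv d) e) _.
apply: etrans (jet_deriv_frac _ (mulf_neq0 q0 s0)) _.
exact: (quot_ruleD (@to_jetfun_eq0 R) dD dM).
Qed.

Lemma jet_derivM F G : leibniz_at (jet_deriv d) F G.
Proof.
rewrite /leibniz_at; have [p [q [q0 ->]]] := jetfun_div F.
have [r [s [s0 ->]]] := jetfun_div G.
have e := rfracM tj p q r s.
rewrite (jet_deriv_frac p q0) (jet_deriv_frac r s0).
apply: etrans (congr1 (jet_deriv d) e) _.
apply: etrans (jet_deriv_frac _ (mulf_neq0 q0 s0)) _.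
exact: (quot_ruleM (@to_jetfun_eq0 R) dM).
Qed.

Lemma jet_deriv_poly p : jet_deriv d (tj p) = tj (d p).
Proof.
have e : tj p = tj p / tj 1 by rewrite rmorph1 divr1.
rewrite e jet_deriv_frac ?oner_neq0 //.
exact: (quot_rule1 _ _ (leibniz1 dM)).
Qed.

End OneDerivation.

Lemma total_derivD : {morph @total_deriv R : F G / F + G}.
Proof. exact: (jet_derivD (@total_deriv_polyD R) (@total_deriv_polyM R)). Qed.

Lemma total_derivM F G : leibniz_at (@total_deriv R) F G.
Proof. exact: (jet_derivM (@total_deriv_polyM R)). Qed.

Lemma total_deriv_tj p : total_deriv (tj p) = tj (total_deriv_poly p).
Proof. exact: (jet_deriv_poly (@total_deriv_polyM R)). Qed.

Lemma total_deriv_const c : total_deriv (tj (constN c)) = 0.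
Proof. by rewrite total_deriv_tj total_deriv_poly_const (rmorph0 tj). Qed.

Lemma total_deriv_var i :
  total_deriv (tj (varN R i)) = if i is l.+1 then tj (varN R l.+2) else 1.
Proof.
rewrite total_deriv_tj total_deriv_poly_var; case: i => // ; exact: (rmorph1 tj).
Qed.

Definition jet_partial i := jet_deriv (@partial_deriv R i).

Lemma jet_partialD i : {morph jet_partial i : F G / F + G}.
Proof. exact: (jet_derivD (@partial_derivD R i) (@partial_derivM R i)). Qed.

Lemma jet_partialM i F G : leibniz_at (jet_partial i) F G.
Proof. exact: (jet_derivM (@partial_derivM R i)). Qed.

Lemma jet_partial_tj i p : jet_partial i (tj p) = tj (partial_deriv i p).
Proof. exact: (jet_deriv_poly (@partial_derivM R i)). Qed.

Local Opaque total_deriv jet_partial.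

Lemma jet_partial_const i c : jet_partial i (tj (constN c)) = 0.
Proof. by rewrite jet_partial_tj partial_deriv_const (rmorph0 tj). Qed.

Lemma jet_partial_var i j : jet_partial i (tj (varN R j)) = (i == j)%:R.
Proof. by rewrite jet_partial_tj partial_deriv_var (rmorph_nat tj). Qed.

Lemma partial_total_bracket i F :
  bracket_at (jet_partial i.+2) (@total_deriv R) (jet_partial i.+1) F.
Proof.
have tjP p : bracket_at (jet_partial i.+2) (@total_deriv R) (jet_partial i.+1) (tj p).
  apply: etrans (congr1 (jet_partial i.+2) (total_deriv_tj p)) _.
  apply: etrans (jet_partial_tj _ _) _.
  apply: etrans (congr1 tj (partial_total_derivC i p)) _.
  apply: etrans (rmorphD tj _ _) _; apply: (congr2 +%R).
    apply: etrans (esym (total_deriv_tj _)) _.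
    exact: (congr1 (@total_deriv R) (esym (jet_partial_tj i.+2 p))).
  exact: (esym (jet_partial_tj i.+1 p)).
have [p [q [q0 ->]]] := jetfun_div F.
apply: (bracket_atM (@jet_partialD i.+2) (@jet_partialM i.+2)
    total_derivD total_derivM (@jet_partialM i.+1) (tjP p)).
exact: (bracket_atV (@jet_partialD i.+2) (@jet_partialM i.+2)
    total_derivD total_derivM (@jet_partialM i.+1) (tj_neq0 q0) (tjP q)).
Qed.

End JetDerivations.

Local Opaque total_deriv jet_partial.

(** * Substitutions as endomorphisms of the fraction field *)

Section FractionExtension.

Variables (P : idomainType) (K L : fieldType) (t : {rmorphism P -> K}).
Hypothesis t_eq0 : forall p, (t p == 0) = (p == 0).
Hypothesis t_frac : forall x, exists pq : P * P, pq.2 != 0 /\ x = t pq.1 / t pq.2.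
Variable s : {rmorphism P -> L}.
Hypothesis s_neq0 : forall p, p != 0 -> s p != 0.

Let num x := (projT1 (cid (t_frac x))).1.
Let den x := (projT1 (cid (t_frac x))).2.

Let ext x : L := s (num x) / s (den x).

Let ext_frac p q : q != 0 -> ext (t p / t q) = s p / s q.
Proof.
rewrite /ext /num /den; case: cid => -[r u] /= [u0 e] q0.
move/eqP: e; rewrite (rfrac_eq t_eq0) // subr_eq0 => /eqP e.
by apply/eqP; rewrite eqr_div ?s_neq0 // -(rmorphM s r) -(rmorphM s p) e.
Qed.

Let ext_zmod_morphism : zmod_morphism ext.
Proof.
move=> x y; have [[p q] /= [q0 ->]] := t_frac x; have [[r u] /= [u0 ->]] := t_frac y.
rewrite (rfracN t) (rfracD t_eq0) // !ext_frac ?mulf_neq0 //.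
by rewrite (rfracN s) (addf_div _ _ (s_neq0 q0) (s_neq0 u0)) rmorphD !rmorphM.
Qed.

Let ext_monoid_morphism : monoid_morphism ext.
Proof.
split.
  have := @ext_frac 1 1 (oner_neq0 _).
  by rewrite !rmorph1 !divr1.
move=> x y; have [[p q] /= [q0 ->]] := t_frac x; have [[r u] /= [u0 ->]] := t_frac y.
by rewrite (rfracM t) !ext_frac ?mulf_neq0 // (rfracM s).
Qed.

(** A morphism that kills no nonzero element makes every denominator invertible, and
    cross-multiplication shows that the quotient is independent of the chosen fraction. *)
Lemma fraction_extension : exists phi : {rmorphism K -> L}, forall p, phi (t p) = s p.
Proof.
pose phi : {rmorphism K -> L} := HB.pack ext
  (GRing.isZmodMorphism.Build K L ext ext_zmod_morphism)
  (GRing.isMonoidMorphism.Build K L ext ext_monoid_morphism).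
exists phi => p; have := @ext_frac p 1 (oner_neq0 _).
by rewrite !rmorph1 !divr1.
Qed.

End FractionExtension.

Section JetSubstitution.

Variable R : realType.
Implicit Types (p q : polyN R) (F G : jetfun R) (V : nat -> jetfun R).

Local Notation tj := (@to_jetfun R).

Definition jconst : R -> jetfun R := fun c => tj (constN c).

Fact jconst_zmod_morphism : zmod_morphism jconst.
Proof. by move=> a b; rewrite /jconst (rmorphB (@constN R)) (rmorphB tj). Qed.

HB.instance Definition _ := GRing.isZmodMorphism.Build R (jetfun R) jconst
  jconst_zmod_morphism.

Fact jconst_monoid_morphism : monoid_morphism jconst.
Proof.
split; first by rewrite /jconst (rmorph1 (@constN R)) (rmorph1 tj).
by move=> a b; rewrite /jconst (rmorphM (@constN R)) (rmorphM tj).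
Qed.

HB.instance Definition _ := GRing.isMonoidMorphism.Build R (jetfun R) jconst
  jconst_monoid_morphism.

Definition jsub V : polyN R -> jetfun R := substN jconst V.

HB.instance Definition _ V := GRing.RMorphism.on (jsub V).

Lemma jsub_const V c : jsub V (constN c) = jconst c.
Proof. exact: substN_const. Qed.

Lemma jsub_var V i : jsub V (varN R i) = V i.
Proof. exact: substN_var. Qed.

Lemma jsub_extension V : (forall p, p != 0 -> jsub V p != 0) ->
  exists phi : {rmorphism jetfun R -> jetfun R}, forall p, phi (tj p) = jsub V p.
Proof.
apply: (fraction_extension (t := tj) (@to_jetfun_eq0 R)) => F.
by have [p [q e]] := jetfun_div F; exists (p, q).
Qed.

Lemma jsub_value V u v p : (forall i, has_value (V i) u (v i)) ->
  has_value (jsub V p) u (ev v p).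
Proof.
move=> Vv; elim/polyN_ind: p => [c|i|p q Hp Hq|p q Hp Hq].
- by rewrite jsub_const ev_const; exact: value_const.
- by rewrite jsub_var ev_var.
- by rewrite (rmorphD (jsub V)) (rmorphD (ev v)); exact: valueD.
- by rewrite (rmorphM (jsub V)) (rmorphM (ev v)); exact: valueM.
Qed.

(** Here [phi] is composition with the coordinate change [u |-> v] described by [V]. A denominator
    of [F] that is nonzero at [v] becomes one that is nonzero at [u], so regularity is transferred
    too. *)
Lemma extension_value V (phi : {rmorphism jetfun R -> jetfun R}) u v F c :
  (forall p, phi (tj p) = jsub V p) -> (forall i, has_value (V i) u (v i)) ->
  has_value F v c -> has_value (phi F) u c.
Proof.
move=> phiV Vv /has_valueP[p [q [-> q0 ->]]].
rewrite (fmorph_div phi) !phiV.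
by apply: value_div => //; exact: jsub_value.
Qed.

(** [N] is the product of numerator and denominator; it serves as the exceptional polynomial in
    density arguments. *)
Lemma jetfun_neq0_ev F : F != 0 ->
  exists2 N, N != 0 & forall u, ev u N != 0 -> exists2 c, has_value F u c & c != 0.
Proof.
have [p [q [q0 ->]]] := jetfun_div F => F0.
have p0 : p != 0.
  by apply: contraNneq F0 => ->; rewrite (rmorph0 tj) mul0r.
exists (p * q); first exact: mulf_neq0.
move=> u; rewrite (ev_mul_neq0 (ev u)) => /andP[pu qu].
exists (ev u p / ev u q); first exact: value_frac.
by rewrite mulf_neq0 // invr_neq0.
Qed.

Lemma jetfun_regular F :
  exists2 N, N != 0 & forall u, ev u N != 0 -> exists c, has_value F u c.
Proof.
have [p [q [q0 ->]]] := jetfun_div F; exists q => // u qu.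
by exists (ev u p / ev u q); exact: value_frac.
Qed.

End JetSubstitution.

(** * The prolonged action *)

Lemma rmorph_leibniz (P L : comNzRingType) (e : {rmorphism P -> L}) (d : P -> P) p q :
  leibniz_at d p q -> e (d (p * q)) = e (d p) * e q + e p * e (d q).
Proof. by rewrite /leibniz_at => ->; rewrite rmorphD !rmorphM. Qed.

Lemma rmorph_quot (P L : comNzRingType) (e : {rmorphism P -> L}) a b c d :
  e a * e b - e c * e d = e (a * b - c * d).
Proof. by rewrite rmorphB !rmorphM. Qed.

Section ChainRule.

Variable R : realType.
Implicit Types (p q : polyN R) (F G : jetfun R) (f g : R -> R) (a : R).

Local Notation tj := (@to_jetfun R).

Definition smooth_at f a := forall l, derivable (derive1n l f) a 1.

Lemma derive1n_is_derive f a l : smooth_at f a ->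
  is_derive a 1 (derive1n l f) (derive1n l.+1 f a).
Proof. by move=> fa; apply: DeriveDef; [exact: fa|rewrite derive1nS derive1E]. Qed.

Lemma is_derive_mul (k m : R -> R) a dk dm :
  is_derive a 1 k dk -> is_derive a 1 m dm ->
  is_derive a 1 (fun t => k t * m t) (dk * m a + k a * dm).
Proof.
move=> ka ma; have H := @is_deriveM _ _ k m a 1 dk dm ka ma.
by apply: is_derive_eq H _; rewrite /GRing.scale /= ; ring.
Qed.

(** The characteristic property of [D_x]: along the jets of a curve it is differentiation in the
    parameter. It is checked on variables and extended by the product rule. *)
Lemma jet_poly_is_derive f a p : smooth_at f a ->
  is_derive a 1 (fun t => ev (jet f t) p) (ev (jet f a) (total_deriv_poly p)).
Proof.
move=> fa; elim/polyN_ind: p => [c|i|p q Hp Hq|p q Hp Hq].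
- rewrite total_deriv_poly_const (rmorph0 (ev _)).
  under eq_fun do rewrite ev_const.
  exact: is_derive_cst.
- rewrite total_deriv_poly_var; under eq_fun do rewrite ev_var.
  case: i => [|l] /=; last by rewrite ev_var; exact: derive1n_is_derive.
  rewrite (rmorph1 (ev _)); exact: is_derive_id.
- rewrite total_deriv_polyD (rmorphD (ev _)).
  under eq_fun do rewrite (rmorphD (ev _)).
  exact: is_deriveD.
- rewrite (rmorph_leibniz (ev _) (total_deriv_polyM p q)).
  have -> : (fun t => ev (jet f t) (p * q)) =
      (fun t => ev (jet f t) p * ev (jet f t) q).
    by apply/funext => t; exact: (rmorphM (ev (jet f t))).
  exact: is_derive_mul.
Qed.

Lemma is_derive_continuous f a df : is_derive a 1 f df -> {for a, continuous f}.
Proof. by move=> fa; apply/differentiable_continuous/derivable1_diffP. Qed.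

Lemma is_derive_quotient (k m : R -> R) a dk dm : m a != 0 ->
  is_derive a 1 k dk -> is_derive a 1 m dm ->
  is_derive a 1 (fun t => k t / m t) ((dk * m a - k a * dm) / m a ^+ 2).
Proof.
move=> ma ka mm; have H := is_derive_mul ka (is_deriveV ma mm).
by apply: is_derive_eq H _; rewrite /GRing.scale /=; field.
Qed.

(** One fraction representing [F] at [jet f a] keeps a nonzero denominator at nearby jets. By
    uniqueness of values [k] is its quotient near [a], and the quotient rule applies. *)
Lemma jet_value_is_derive f a F (k : R -> R) : smooth_at f a ->
  (\forall t \near a, has_value F (jet f t) (k t)) ->
  exists2 m, is_derive a 1 k m & has_value (total_deriv F) (jet f a) m.
Proof.
move=> fa Fk.
have [p [q [eF qa _]]] := has_valueP (nbhs_singleton Fk).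
have dp := jet_poly_is_derive p fa; have dq := jet_poly_is_derive q fa.
have qn : \forall t \near a, ev (jet f t) q != 0.
  have := is_derive_continuous dq.
  move=> /(@cvgr_neq0 _ _ _ _ _ (fun t => ev (jet f t) q)); exact.
exists ((ev (jet f a) (total_deriv_poly p) * ev (jet f a) q -
  ev (jet f a) p * ev (jet f a) (total_deriv_poly q)) / ev (jet f a) q ^+ 2).
  apply: near_eq_is_derive (is_derive_quotient qa dp dq).
  near=> t; have Ft : has_value F (jet f t) (k t) by near: t.
  have qt : ev (jet f t) q != 0 by near: t.
  by apply: value_unique Ft; rewrite eF; exact: value_frac.
have -> : total_deriv F = quot_rule tj (@total_deriv_poly R) p q.
  by rewrite eF; exact: (jet_deriv_frac (@total_deriv_polyM R) p (ev_neq0 qa)).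
rewrite (rmorph_quot (ev _)) -(rmorphXn (ev _)).
by apply: value_frac; rewrite (rmorphXn (ev _)) expf_neq0.
Unshelve. all: by end_near. Qed.

End ChainRule.

Section Prolongation.

Variable R : realType.
Implicit Types (h : 'M[R]_2 * R) (f g : R -> R) (a : R) (A : 'M[R]_2).

Local Notation tj := (@to_jetfun R).
Local Notation x := (jx R).
Local Notation y := (jy R 0).
Local Notation y1 := (jy R 1).
Local Notation jc := (@jconst R).

Definition det2 A := A 0 0 * A 1 1 - A 1 0 * A 0 1.

Lemma lift_ord01 : lift ord0 ord0 = 1 :> 'I_2.
Proof. exact/val_inj. Qed.

Lemma csp_actE h t s i : csp_act h (pt t s) i 0 = h.2 * (h.1 i 0 * t + h.1 i 1 * s).
Proof.
by rewrite /csp_act /pt !mxE !big_ord_recl big_ord0 lift_ord01 !mxE /= addr0.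
Qed.

Lemma Sp2P A : Sp2 A <-> det2 A = 1.
Proof.
split=> [SA|dA].
  have := SA (pt 1 0) (pt 0 1).
  rewrite /omega /pt !mxE !big_ord_recl !big_ord0 lift_ord01 !mxE /=.
  by rewrite !(mulr1, mulr0, addr0, add0r) subr0.
move=> p q; rewrite /omega !mxE !big_ord_recl !big_ord0.
rewrite lift_ord01 !addr0 -[RHS]mul1r -dA /det2 /=; ring.
Qed.

(* The jet coordinates of the image of a graph under h, as rational functions of *)
(* the original ones; prol_w h is the total derivative of the new abscissa.      *)
Definition prol_x h : jetfun R := jc (h.2 * h.1 0 0) * x + jc (h.2 * h.1 0 1) * y.
Definition prol_y h : jetfun R := jc (h.2 * h.1 1 0) * x + jc (h.2 * h.1 1 1) * y.
Definition prol_w h : jetfun R := jc (h.2 * h.1 0 0) + jc (h.2 * h.1 0 1) * y1.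

Definition prol_coord h (i : nat) : jetfun R :=
  if i is l.+1 then iter l (fun F => total_deriv F / prol_w h) (prol_y h)
  else prol_x h.

(** The speed of the new abscissa along a curve with jet [u]. Where it is nonzero, the image of the
    curve under [h] is locally a graph. *)
Definition wval h (u : nat -> R) := h.2 * h.1 0 0 + h.2 * h.1 0 1 * u 2%N.

Lemma prol_w_value h u : has_value (prol_w h) u (wval h u).
Proof.
apply: valueD; first exact: value_const.
by apply: valueM; [exact: value_const|exact: value_var].
Qed.

Lemma wval_jet h f a :
  wval h (jet f a) = h.2 * (h.1 0 0 + h.1 0 1 * derive1n 1 f a).
Proof. by rewrite /wval mulrDr mulrA. Qed.

(** The curve-level content of [prolong], without the jets [u] and [v]. In this form it is an open
    condition on [a], so relations between jet coordinates can be differentiated. *)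
Definition prolong_at h f g a :=
  [/\ \forall t \near a, smooth_at f t,
      \forall t \near csp_act h (pt a (f a)) 0 0, smooth_at g t
    & \forall t \near a,
        csp_act h (pt t (f t)) 1 0 = g (csp_act h (pt t (f t)) 0 0)].

Lemma prolongP h u v : prolong h u v <-> exists f g,
  [/\ prolong_at h f g (u 0%N), u = jet f (u 0%N)
    & v = jet g (csp_act h (pt (u 0%N) (f (u 0%N))) 0 0)].
Proof.
split=> [[f [g [[fs uf] [gs vg] v0 fg]]]|[f [g [[fs gs fg] uf vg]]]].
  exists f, g; rewrite /prolong_at -v0.
  by split; [split; [exact: fs|exact: gs|exact: fg]|exact: uf|exact: vg].
exists f, g; have v0 : v 0%N = csp_act h (pt (u 0%N) (f (u 0%N))) 0 0 by rewrite vg.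
rewrite v0; split; [split; [exact: fs|exact: uf]|split; [exact: gs|exact: vg]| |].
  exact: erefl.
exact: fg.
Qed.

Lemma prol_comp_is_derive h f a i : smooth_at f a ->
  is_derive a 1 (fun t => csp_act h (pt t (f t)) i 0)
    (h.2 * (h.1 i 0 + h.1 i 1 * derive1n 1 f a)).
Proof.
move=> fa; under eq_fun do rewrite csp_actE.
have df := derive1n_is_derive 0 fa; rewrite derive1n0 in df.
apply: is_derive_eq.
by rewrite /GRing.scale /=; ring.
Qed.

Lemma prolong_near h f g a :
  prolong_at h f g a -> \forall t \near a, prolong_at h f g t.
Proof.
move=> [fs gs fg].
have fa := nbhs_singleton fs.
have phic := is_derive_continuous (prol_comp_is_derive h 0 fa).
have gs' : \forall t \near a,
    \forall s \near csp_act h (pt t (f t)) 0 0, smooth_at g s.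
  exact: phic _ (near_join gs).
have fs' := near_join fs; have fg' := near_join fg.
by move: fs' gs' fg'; apply: filterS3 => t; split.
Qed.

(** The new ordinate is [g] of the new abscissa. If the latter had derivative zero, so would the
    former, and the invertible matrix would kill the tangent vector [(1, f')]. *)
Lemma prolong_wval h f g a : CSp2 h -> prolong_at h f g a -> wval h (jet f a) != 0.
Proof.
move=> [/Sp2P dA c0] [/nbhs_singleton fa /nbhs_singleton ga fg].
have dphi := prol_comp_is_derive h 0 fa.
have dpsi := prol_comp_is_derive h 1 fa.
have dg := derive1n_is_derive 0 ga; rewrite derive1n0 in dg.
have dcomp := near_eq_is_derive fg dpsi.
have e := is_derive1_comp dg dphi.
have := @derive_val _ _ _ _ _ _ _ dcomp.
rewrite (@derive_val _ _ _ _ _ _ _ e) => e'.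
apply/eqP; rewrite wval_jet => w0.
have w1 : h.1 0 0 + h.1 0 1 * derive1n 1 f a = 0.
  by apply: (mulfI (lt0r_neq0 c0)); rewrite mulr0 -w0.
move: e'; rewrite w1 !mulr0 => /esym/eqP; rewrite mulf_eq0 (negPf (lt0r_neq0 c0)) /=.
move=> /eqP w2; have : 1 = 0 :> R; last by move/eqP; rewrite oner_eq0.
rewrite -dA /det2.
transitivity (h.1 1 1 * (h.1 0 0 + h.1 0 1 * derive1n 1 f a) -
  h.1 0 1 * (h.1 1 0 + h.1 1 1 * derive1n 1 f a)); first by ring.
by rewrite w1 w2 !mulr0 subrr.
Qed.

(** The equality for order [l] holds at all points near [a]. Differentiating it, the chain rule
    gives the next derivative of [g] times the speed [wval], by which [prol_coord] divides. *)
Lemma prolong_at_value h f g a l : CSp2 h -> prolong_at h f g a ->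
  has_value (prol_coord h l.+1) (jet f a)
    (derive1n l g (csp_act h (pt a (f a)) 0 0)).
Proof.
move=> hC; elim: l a => [|l IHl] a fga.
  have [_ _ /nbhs_singleton fg] := fga.
  rewrite derive1n0 -fg csp_actE /= mulrDr !mulrA.
  by apply: valueD; apply: valueM; [exact: value_const|exact: (value_var 0)|
    exact: value_const|exact: (value_var 1)].
have [/nbhs_singleton fa /nbhs_singleton ga _] := fga.
have near_values : \forall t \near a, has_value (prol_coord h l.+1) (jet f t)
    (derive1n l g (csp_act h (pt t (f t)) 0 0)).
  by have := prolong_near fga; apply: filterS => t; exact: IHl.
have [m dm vm] := jet_value_is_derive fa near_values.
have dphi := prol_comp_is_derive h 0 fa.
have e := is_derive1_comp (derive1n_is_derive l ga) dphi.
have := @derive_val _ _ _ _ _ _ _ dm.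
rewrite (@derive_val _ _ _ _ _ _ _ e) => em.
have w0 := prolong_wval hC fga.
have -> : derive1n l.+1 g (csp_act h (pt a (f a)) 0 0) = m / wval h (jet f a).
  by apply/(canRL (mulfK w0)); rewrite -em wval_jet.
exact: value_div vm (prol_w_value h _) w0.
Qed.

Lemma prolong_value h u v i : CSp2 h -> prolong h u v ->
  has_value (prol_coord h i) u (v i).
Proof.
move=> hC /prolongP[f [g [fga uf vg]]].
case: i => [|l]; last by rewrite vg uf; exact: prolong_at_value.
have -> : v 0%N = csp_act h (pt (u 0%N) (u 1%N)) 0 0 by rewrite vg uf.
rewrite csp_actE mulrDr !mulrA.
by apply: valueD; apply: valueM; [exact: value_const|exact: (value_var 0)|
    exact: value_const|exact: (value_var 1)].
Qed.

End Prolongation.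

(** * Local inverses of polynomials and existence of prolongations *)

Section LocalInverse.

Variable R : realType.
Implicit Types (P Q T : {poly R}) (a t r : R) (s : R -> R).

(** By the mean value theorem, two points with the same value would enclose a zero of the
    derivative. *)
Lemma poly_locally_injective P a : P^`().[a] != 0 ->
  exists2 e, 0 < e & (forall t, `|t - a| < e -> P^`().[t] != 0) /\
    (forall t r, `|t - a| < e -> `|r - a| < e -> P.[t] = P.[r] -> t = r).
Proof.
move=> Pa.
have [e /= e0 Pe] : \forall t \near a, P^`().[t] != 0.
  exact: (cvgr_neq0 _ (@continuous_horner _ P^`() a) Pa).
have Pne t : `|t - a| < e -> P^`().[t] != 0 by move=> ta; apply: Pe; rewrite /= distrC.
exists e => //; split=> //.
have lt_neq t r : `|t - a| < e -> `|r - a| < e -> t < r -> P.[t] <> P.[r].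
  move=> ta ra tr eP.
  have [c] := @MVT_segment _ (horner P) (horner P^`()) t r (ltW tr)
    (fun x _ => is_derive_poly P x)
    (continuous_subspaceT (@continuous_horner _ P)).
  rewrite in_itv /= => /andP[tc cr] /eqP.
  rewrite eP subrr eq_sym mulf_eq0 subr_eq0 (gt_eqF tr) orbF; apply/negP.
  apply: Pne; move: ta ra; rewrite !ltr_distl => /andP[ta _] /andP[_ ra].
  by apply/andP; split; [exact: lt_le_trans ta tc|exact: le_lt_trans cr ra].
move=> t r ta ra eP; have [tr|rt|//] := ltgtP t r.
  by case: (lt_neq t r).
by case: (lt_neq r t) => //; rewrite eP.
Qed.

Definition local_inverse P s a :=
  (\forall t \near a, s P.[t] = t) /\
  (\forall r \near P.[a], [/\ P.[s r] = r, P^`().[s r] != 0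
     & is_derive r 1 s (P^`().[s r])^-1]).

Lemma poly_local_inverse P a : P^`().[a] != 0 -> exists s, local_inverse P s a.
Proof.
move=> /poly_locally_injective [e e0 [Pne Pinj]].
(* The inverse selects the preimage inside the ball, with [a] as the default where there is none. *)
pose s r := xget a [set t | `|t - a| < e /\ P.[t] = r].
have sK t : `|t - a| < e -> s P.[t] = t.
  move=> ta; have [] := @xgetPex _ a [set t' | `|t' - a| < e /\ P.[t'] = P.[t]].
    by exists t.
  by move=> sa sP; apply: Pinj.
have ball : \forall t \near a, `|t - a| < e.
  by exists e => // t /=; rewrite distrC.
have nK : \forall t \near a, s P.[t] = t by apply: filterS ball.
have nC : {near a, continuous (horner P)}.
  by near do exact: continuous_horner.
have good : \forall t \near a, P^`().[t] != 0 /\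
    is_derive P.[t] 1 s (P^`().[t])^-1.
  have nK' := near_join nK.
  near=> t.
  have ta : `|t - a| < e by near: t.
  split; first exact: Pne.
  have tK : {near t, cancel (horner P) s} by near: t; exact: nK'.
  have tC : {near t, continuous (horner P)} by near do exact: continuous_horner.
  exact: (is_derive_inverse tK tC (is_derive_poly P t) (Pne t ta)).
have sc := nbhs_singleton (near_can_continuous nK nC).
have Ks := near_continuous_can_sym nC nK.
exists s; split => //.
have sPa : s P.[a] = a by exact: nbhs_singleton nK.
have good' : \forall r \near P.[a], P^`().[s r] != 0 /\
    is_derive P.[s r] 1 s (P^`().[s r])^-1.
  by apply: (sc (fun t => P^`().[t] != 0 /\ is_derive P.[t] 1 s (P^`().[t])^-1)); rewrite sPa.
near=> r.
have rK : P.[s r] = r by near: r.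
have [] : P^`().[s r] != 0 /\ is_derive P.[s r] 1 s (P^`().[s r])^-1 by near: r.
by rewrite rK.
Unshelve. all: by end_near. Qed.

Lemma is_derive_horner_inverse P s T S r : P^`().[s r] != 0 -> S.[s r] != 0 ->
  is_derive r 1 s (P^`().[s r])^-1 ->
  is_derive r 1 (fun x => T.[s x] / S.[s x])
    ((T^`() * S - T * S^`()).[s r] / (S ^+ 2 * P^`()).[s r]).
Proof.
move=> P0 S0 ds.
have dT := is_derive1_comp (is_derive_poly T (s r)) ds.
have dS := is_derive1_comp (is_derive_poly S (s r)) ds.
have H := @is_derive_quotient R (fun x => T.[s x]) (fun x => S.[s x]) r _ _ S0 dT dS.
apply: is_derive_eq H _.
by rewrite !hornerE /=; field; rewrite P0 S0.
Qed.

(* All derivatives of Q \o s have the form (T / P'^k) \o s, T a polynomial. *)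
Lemma horner_inverse_smooth P s a Q : local_inverse P s a ->
  \forall r \near P.[a], smooth_at (fun x => Q.[s x]) r.
Proof.
move=> [_ /near_join good]; apply: filterS (good) => r gr l.
suff [T [k eT]] : exists T k, forall r', (\forall x \near r',
    [/\ P.[s x] = x, P^`().[s x] != 0 & is_derive x 1 s (P^`().[s x])^-1]) ->
    derive1n l (fun x => Q.[s x]) r' = T.[s r'] / (P^`() ^+ k).[s r'].
  have [_ P0 ds] := nbhs_singleton gr.
  have S0 : (P^`() ^+ k).[s r] != 0 by rewrite horner_exp expf_neq0.
  have D := is_derive_horner_inverse T P0 S0 ds.
  apply: (@ex_derive _ _ _ _ _ _ _ (near_eq_is_derive _ D)).
  by apply: filterS (near_join gr) => x gx; rewrite eT.
elim: l => [|l [T [k eT]]].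
  by exists Q, 0%N => x _; rewrite derive1n0 expr0 hornerC divr1.
(* The quotient rule squares the denominator [P'^k], and the derivative of [s] contributes one more
   factor [P']. *)
exists (T^`() * P^`() ^+ k - T * (P^`() ^+ k)^`()), (k * 2).+1 => r' gr'.
have [_ P0 ds] := nbhs_singleton gr'.
have S0 : (P^`() ^+ k).[s r'] != 0 by rewrite horner_exp expf_neq0.
have D := is_derive_horner_inverse T P0 S0 ds.
rewrite derive1nS derive1E exprSr exprM.
apply: derive_val; apply: near_eq_is_derive D.
by apply: filterS (near_join gr') => x gx; rewrite eT.
Qed.

Lemma derive1n_horner Q l : derive1n l (horner Q) = horner (Q^`(l)).
Proof.
elim: l => [|l IHl]; first by rewrite derive1n0.
by rewrite derive1nS IHl -derivE derivnS.
Qed.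

Lemma horner_smooth Q t : smooth_at (horner Q) t.
Proof. by move=> l; rewrite derive1n_horner; exact: derivable_horner. Qed.

Lemma finite_jet_poly (u : nat -> R) : finite_jet u ->
  exists Q, u = jet (horner Q) (u 0%N).
Proof.
(* The Taylor polynomial with prescribed derivatives: [u l.+1] is the value of y_l. *)
move=> [n un]; pose q := \poly_(l < n) (u l.+1 / l`!%:R).
exists (q \Po ('X - (u 0%N)%:P)); apply/funext => -[|l] //=.
rewrite derive1n_horner.
have -> : (q \Po ('X - (u 0%N)%:P))^`(l) = q^`(l) \Po ('X - (u 0%N)%:P).
  elim: l => [|l IHl]; first by rewrite !derivn0.
  by rewrite derivnS IHl deriv_comp derivB derivX derivC subr0 mulr1 -derivnS.
rewrite horner_comp !hornerE subrr horner_coef0 coef_derivn addn0 ffactnn.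
rewrite coef_poly; case: ltnP => [_|ln]; last by rewrite un ?mul0rn // leqW.
by rewrite -[RHS]mulr_natr divfK // pnatr_eq0 -lt0n fact_gt0.
Qed.

End LocalInverse.

Section ProlongationExists.

Variable R : realType.
Implicit Types (h : 'M[R]_2 * R) (Q : {poly R}) (a : R).

Definition csp_inv h : 'M[R]_2 * R := (invmx h.1, h.2^-1).

Lemma Sp2_unitmx (A : 'M[R]_2) : Sp2 A -> A \in unitmx.
Proof.
move=> /Sp2P dA; rewrite unitmxE.
have -> : \det A = det2 A.
  rewrite (expand_det_row _ 0) !big_ord_recl big_ord0 /cofactor !det_mx11 !mxE /=.
  have l10 : lift 1 0 = 0 :> 'I_2 by exact/val_inj.
  rewrite /det2 !lift_ord01 l10 /bump /= addn0 addn1 expr0 expr1.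
  change (ord0 : 'I_2) with (0 : 'I_2); ring.
by rewrite dA unitr1.
Qed.

Lemma csp_invP h : CSp2 h -> CSp2 (csp_inv h).
Proof.
move=> [SA c0]; split=> /=; last by rewrite invr_gt0.
by move=> p q; rewrite -SA !mulmxA mulmxV ?Sp2_unitmx // !mul1mx.
Qed.

Lemma csp_actK h p : CSp2 h -> csp_act (csp_inv h) (csp_act h p) = p.
Proof.
move=> [SA c0]; rewrite /csp_act /= -scalemxAr scalerA mulVf ?gt_eqF // scale1r.
by rewrite mulmxA mulVmx ?Sp2_unitmx // mul1mx.
Qed.

Lemma csp_invK h : CSp2 h -> csp_inv (csp_inv h) = h.
Proof. by case: h => A c _; rewrite /csp_inv /= invmxK invrK. Qed.

Lemma pt_eta (p : 'cV[R]_2) : pt (p 0 0) (p 1 0) = p.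
Proof.
apply/colP => i; rewrite mxE; case: (eqVneq i 0) => [->//|i0].
by have -> : i = 1 by apply/val_inj; case: i i0 => [[|[|[]]]].
Qed.

Definition csp_poly h Q (i : 'I_2) : {poly R} :=
  (h.2 * h.1 i 0) *: 'X + (h.2 * h.1 i 1) *: Q.

Lemma csp_polyE h Q i t : (csp_poly h Q i).[t] = csp_act h (pt t Q.[t]) i 0.
Proof. by rewrite csp_actE !hornerE mulrDr !mulrA. Qed.

(** The image of the graph is parametrized by two polynomials [P] and [S]. With [s] a local inverse
    of [P], it is the graph of [S \o s], and reading the same pair of curves backwards gives the
    prolongation of the inverse element. *)
Lemma prolong_poly h Q a : CSp2 h -> wval h (jet (horner Q) a) != 0 ->
  exists v, prolong h (jet (horner Q) a) v /\
            prolong (csp_inv h) v (jet (horner Q) a).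
Proof.
move=> hC w0; pose P := csp_poly h Q 0; pose S := csp_poly h Q 1.
have P0 : P^`().[a] != 0.
  move: w0; rewrite wval_jet derive1n_horner derivn1; congr (_ != 0).
  by rewrite /P /csp_poly derivD !derivZ derivX !hornerE mulrDr !mulrA.
have [s sP] := poly_local_inverse P0.
pose g x := S.[s x].
have gs := horner_inverse_smooth S sP; rewrite -/g in gs.
have [sK good] := sP.
have phiE t : csp_act h (pt t Q.[t]) 0 0 = P.[t] by rewrite csp_polyE.
have psiE t : csp_act h (pt t Q.[t]) 1 0 = S.[t] by rewrite csp_polyE.
have inv_near : \forall r \near P.[a],
    csp_act (csp_inv h) (pt r (g r)) = pt (s r) Q.[s r].
  apply: filterS good => r [rK _ _].
  by rewrite -{1}rK /g -phiE -psiE pt_eta csp_actK.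
have sPa := nbhs_singleton sK.
have base := nbhs_singleton inv_near.
exists (jet g P.[a]); split; apply/prolongP.
  exists (horner Q), g; split; [|exact: erefl|by rewrite [jet _ _ 0%N]/= phiE].
  rewrite [jet _ _ 0%N]/=; split.
  - by near do exact: horner_smooth.
  - by rewrite phiE; exact: gs.
  - by apply: filterS sK => t tK; rewrite phiE psiE /g tK.
exists g, (horner Q); rewrite [jet _ _ 0%N]/=; split; [|exact: erefl|]; last first.
  by rewrite base mxE /= sPa.
split; first exact: gs.
  by near do exact: horner_smooth.
by apply: filterS inv_near => r ->; rewrite !mxE.
Unshelve. all: by end_near. Qed.

Lemma prolong_exists h u : CSp2 h -> finite_jet u -> wval h u != 0 ->
  exists v, prolong h u v /\ prolong (csp_inv h) v u.
Proof.
by move=> hC /finite_jet_poly[Q uQ]; rewrite uQ => w0; exact: prolong_poly.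
Qed.

End ProlongationExists.

(** * Weights of the invariants under the conformal symplectic group *)

Section ConformalWeights.

Variables (K : fieldType) (D : K -> K) (phi : {rmorphism K -> K}) (W : K).
Hypothesis DD : {morph D : p q / p + q}.
Hypothesis DM : forall p q, leibniz_at D p q.
Hypothesis Dphi : forall F, D (phi F) = W * phi (D F).
Hypothesis W0 : W != 0.
Variables (x y y1 y2 a b a' b' : K).
Hypotheses (Da : D a = 0) (Db : D b = 0) (Da' : D a' = 0) (Db' : D b' = 0).
Hypotheses (Dx : D x = 1) (Dy : D y = y1) (Dy1 : D y1 = y2).
Hypotheses (phix : phi x = a * x + b * y) (phiy : phi y = a' * x + b' * y).

Let e := a * b' - a' * b.
Hypothesis e0 : e != 0.

Let w := x * y1 - y.
Hypothesis w0 : w != 0.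

Let DW : W = a + b * y1.
Proof.
have := Dphi x; rewrite Dx rmorph1 mulr1 phix => <-.
by rewrite DD !DM Da Db Dx Dy; ring.
Qed.

Let phiy1 : phi y1 = (a' + b' * y1) / W.
Proof.
have := Dphi y; rewrite Dy phiy DD !DM Da' Db' Dx Dy => h.
by apply: (mulfI W0); rewrite -h; field.
Qed.

(** [w] is the area form on the position and the tangent [(1, y1)]. The linear map multiplies it by
    its determinant [e], and rescaling the tangent to first component 1 divides by [W]. *)
Lemma phi_w : phi w = e * w / W.
Proof. by rewrite /w rmorphB rmorphM phiy1 phix phiy /e DW; field; rewrite -DW. Qed.

Lemma phi_y2 : phi y2 = e * y2 / W ^+ 3.
Proof.
have D1 : D (a' + b' * y1) = b' * y2 by rewrite DD DM Da' Db' Dy1; ring.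
have D2 : D W = b * y2 by rewrite DW DD DM Da Db Dy1; ring.
have := Dphi y1; rewrite Dy1 phiy1 (derivation_div DM) // D1 D2 => h.
by apply: (mulfI W0); rewrite -h /e [in LHS]DW [in RHS]DW; field; rewrite -DW.
Qed.

Definition nab F := 1 / w * D F.

(** The factor [W] of the chain rule cancels against the one in [phi w]; only the constant [e] is
    left. *)
Lemma phi_nab F : phi (nab F) = e^-1 * nab (phi F).
Proof.
rewrite /nab rmorphM fmorph_div rmorph1 phi_w Dphi; field.
by rewrite w0 W0 e0.
Qed.

Let I2 := y2 / w ^+ 3.

(** [y2] contributes [e / W^3] and [w^3] contributes [e^3 / W^3]; the exponent 3 is the one for
    which [W] disappears. *)
Lemma phi_I2 : phi I2 = e^-1 ^+ 2 * I2.
Proof.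
rewrite /I2 fmorph_div rmorphXn phi_w phi_y2; field.
by rewrite w0 W0 e0.
Qed.

Let De : D e = 0.
Proof. by rewrite /e (derivationB DD) !DM Da Db Da' Db'; ring. Qed.

Let DeX n : D (e^-1 ^+ n) = 0.
Proof.
case: n => [|n]; first by rewrite expr0 (derivation1 DM).
by rewrite (derivationXS DM) (derivationV DM) // De; ring.
Qed.

(** As [e] is annihilated by [D], each application of [nab] contributes exactly one more factor
    [e^-1]. *)
Lemma phi_iter_nab n : phi (iter n nab I2) = e^-1 ^+ n.+2 * iter n nab I2.
Proof.
elim: n => [|n IHn]; first exact: phi_I2.
rewrite [iter n.+1 nab _]iterS phi_nab IHn /nab DM DeX [_ ^+ n.+3]exprS.
by ring.
Qed.

Let I3 := nab I2.
Hypotheses (y20 : y2 != 0) (I30 : I3 != 0).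

Let J := I3 ^+ 2 / I2 ^+ 3.
Let nab' F := I2 / I3 * nab F.

Let phi_I3 : phi I3 = e^-1 ^+ 3 * I3.
Proof. exact: (phi_iter_nab 1). Qed.

Let I20 : I2 != 0.
Proof. by rewrite /I2 mulf_neq0 ?invr_neq0 ?expf_neq0. Qed.

(** [I2 / I3] has weight [e], which compensates the weight [e^-1] of [nab]. *)
Lemma phi_nab' F : phi (nab' F) = nab' (phi F).
Proof.
rewrite /nab' rmorphM fmorph_div phi_nab phi_I2 phi_I3; field.
by rewrite I30 e0.
Qed.

Lemma phi_J : phi J = J.
Proof.
rewrite /J fmorph_div !rmorphXn phi_I2 phi_I3; field.
by rewrite I20 e0.
Qed.

End ConformalWeights.

Local Opaque constN varN to_jetfun.

Lemma derivation_affine (K : fieldType) (d : K -> K) a b x y y1 :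
  {morph d : p q / p + q} -> (forall p q, leibniz_at d p q) ->
  d a = 0 -> d b = 0 -> d x = 1 -> d y = y1 -> d (a * x + b * y) = a + b * y1.
Proof. by move=> dD dM da db dx dy; rewrite dD !dM da db dx dy; ring. Qed.

Lemma phi_mul0 (K : fieldType) (phi : {rmorphism K -> K}) a : 0 = a * phi 0.
Proof. by rewrite rmorph0 mulr0. Qed.

Lemma phi_mul1 (K : fieldType) (phi : {rmorphism K -> K}) a : a = a * phi 1.
Proof. by rewrite rmorph1 mulr1. Qed.

Lemma field_divK (K : fieldType) (a b : K) : b != 0 -> a = b * (a / b).
Proof. by move=> b0; rewrite mulrC divfK. Qed.

Lemma rmorph_scaled_det (L K : comNzRingType) (f : {rmorphism L -> K}) (c p q r s : L) :
  p * s - r * q = 1 ->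
  f (c * p) * f (c * s) - f (c * r) * f (c * q) = f (c ^+ 2).
Proof.
move=> e1; rewrite -!rmorphM -rmorphB; congr (f _).
by rewrite -[RHS]mulr1 -e1; ring.
Qed.

Lemma rmorph_expf_neq0 (L K : fieldType) (f : {rmorphism L -> K}) c n :
  c != 0 -> f (c ^+ n) != 0.
Proof. by move=> c0; rewrite fmorph_eq0 expf_neq0. Qed.

(** * The field endomorphism of a group element *)

Section GroupMorphism.

Variable R : realType.
Implicit Types (h : 'M[R]_2 * R) (p q : polyN R) (F G : jetfun R) (u v : nat -> R).

Local Notation tj := (@to_jetfun R).
Local Notation jc := (@jconst R).
Local Notation x := (jx R).
Local Notation y := (jy R 0).
Local Notation y1 := (jy R 1).
Local Notation y2 := (jy R 2).

Lemma evM_neq0 u p q : (ev u (p * q) != 0) = (ev u p != 0) && (ev u q != 0).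
Proof. exact: (ev_mul_neq0 (ev u)). Qed.

Lemma csp_scale_gt0 h : CSp2 h -> 0 < h.2. Proof. by case. Qed.

Lemma csp_det h : CSp2 h -> det2 h.1 = 1. Proof. by case=> /Sp2P. Qed.

Definition wpoly h : polyN R :=
  constN (h.2 * h.1 0 0) + constN (h.2 * h.1 0 1) * varN R 2.

Lemma ev_wpoly h u : ev u (wpoly h) = wval h u.
Proof.
apply: etrans (rmorphD (ev u) _ _) (congr2 +%R (ev_const u _) _).
exact: etrans (rmorphM (ev u) _ _) (congr2 *%R (ev_const u _) (ev_var u 2)).
Qed.

Lemma wpoly_neq0 h : CSp2 h -> wpoly h != 0.
Proof.
move=> hC; have c0 := csp_scale_gt0 hC; have dA := csp_det hC.
have [a0|a0] := eqVneq (h.1 0 0) 0; last first.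
  apply: (@ev_neq0 _ (fun=> 0)); rewrite ev_wpoly /wval mulr0 addr0.
  by rewrite mulf_neq0 // gt_eqF.
apply: (@ev_neq0 _ (fun=> 1)); rewrite ev_wpoly /wval a0 mulr0 add0r mulr1.
rewrite mulf_neq0 ?(lt0r_neq0 c0) //; apply/eqP => b0; move/eqP: dA.
by rewrite /det2 a0 b0 mul0r mulr0 subrr eq_sym oner_eq0.
Qed.

Lemma prol_w_tj h : prol_w h = tj (wpoly h).
Proof.
apply: etrans _ (esym (rmorphD tj _ _)).
exact: (congr2 +%R (erefl _) (esym (rmorphM tj _ _))).
Qed.

Lemma prol_w_neq0 h : CSp2 h -> prol_w h != 0.
Proof. by move=> hC; rewrite prol_w_tj; exact: tj_neq0 (wpoly_neq0 hC). Qed.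

(** A finite jet [v] is chosen with [p] nonzero at [v] and the inverse of [h] defined there. It is
    the image under [h] of some [u], at which the substituted polynomial takes the value of [p] at
    [v]. *)
Lemma jsub_prol_neq0 h p : CSp2 h -> p != 0 -> jsub (prol_coord h) p != 0.
Proof.
move=> hC p0; have hC' := csp_invP hC.
have [v pv vfin] := ev_neq0_exists (mulf_neq0 p0 (wpoly_neq0 hC')).
move: pv; rewrite evM_neq0 ev_wpoly => /andP[pv wv].
have [u [_]] := prolong_exists hC' vfin wv.
rewrite csp_invK // => uv.
apply: value_neq0 pv; apply: jsub_value => i; exact: prolong_value uv.
Qed.

Lemma csp_morphism h : CSp2 h -> exists phi : {rmorphism jetfun R -> jetfun R},
  forall p, phi (tj p) = jsub (prol_coord h) p.
Proof. by move=> hC; apply: jsub_extension => p; exact: jsub_prol_neq0. Qed.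

Section OneElement.

Variables (h : 'M[R]_2 * R) (phi : {rmorphism jetfun R -> jetfun R}).
Hypothesis hC : CSp2 h.
Hypothesis phiE : forall p, phi (tj p) = jsub (prol_coord h) p.

Lemma csp_phi_const c : phi (tj (constN c)) = jc c.
Proof. by rewrite phiE jsub_const. Qed.

Lemma csp_phi_var i : phi (tj (varN R i)) = prol_coord h i.
Proof. by rewrite phiE jsub_var. Qed.

Lemma total_deriv_jc c : total_deriv (jc c) = 0.
Proof. exact: total_deriv_const. Qed.

Lemma total_deriv_x : total_deriv x = 1.
Proof. exact: (total_deriv_var R 0). Qed.

Lemma total_deriv_y l : total_deriv (jy R l) = jy R l.+1.
Proof. exact: (total_deriv_var R l.+1). Qed.

Lemma total_deriv_prol_x : total_deriv (prol_x h) = prol_w h.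
Proof.
exact: (derivation_affine (@total_derivD R) (@total_derivM R)
  (total_deriv_jc _) (total_deriv_jc _) total_deriv_x (total_deriv_y 0)).
Qed.

(** On the variables this is the recursion that defines [prol_coord]. *)
Lemma csp_phi_chain F : total_deriv (phi F) = prol_w h * phi (total_deriv F).
Proof.
elim/jetfun_ind: F => [c|i|F G|F G|F].
- rewrite csp_phi_const !total_deriv_jc; exact: phi_mul0.
- rewrite csp_phi_var total_deriv_var; case: i => [|l].
    rewrite total_deriv_prol_x; exact: phi_mul1.
  rewrite csp_phi_var; exact: field_divK (prol_w_neq0 hC).
- exact: (chain_atD (@total_derivD R)).
- exact: (chain_atM (@total_derivM R)).
- exact: (chain_atV (@total_derivM R)).
Qed.

Lemma csp_phi_value u v F c :
  prolong h u v -> has_value F v c -> has_value (phi F) u c.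
Proof.
move=> uv; apply: (extension_value phiE) => i; exact: prolong_value.
Qed.

Lemma csp_phi_pullback F : is_pullback h F (phi F).
Proof.
move=> u v uv b c Gb Fc.
exact: value_unique Gb (csp_phi_value uv Fc).
Qed.

(** A pullback is constrained only at jets where both functions are regular. Outside the zero set of
    one polynomial every finite jet is such and can be moved by [h], so density determines [G]. *)
Lemma is_pullback_eq F G : is_pullback h F G -> G = phi F.
Proof.
move=> FG; have [p [q [q0 eF]]] := jetfun_div F.
have [N1 N10 V1] := jetfun_neq0_ev (jsub_prol_neq0 hC q0).
have [N2 N20 V2] := jetfun_regular G.
have N0 : N1 * (N2 * wpoly h) != 0.
  by do 2?[apply: mulf_neq0 => //]; exact: wpoly_neq0.
apply: (value_density1 N0) => u ufin.
rewrite !evM_neq0 ev_wpoly => /and3P[/V1[c1 qc c10] /V2[b Gb] wu].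
have [v [uv _]] := prolong_exists hC ufin wu.
have qv : ev v q != 0.
  suff -> : ev v q = c1 by [].
  apply: value_unique qc; apply: jsub_value => i; exact: prolong_value.
have Fc : has_value F v (ev v p / ev v q) by rewrite eF; exact: value_frac.
have e := FG u v uv _ _ Gb Fc.
exists b => //; rewrite e; exact: csp_phi_value uv Fc.
Qed.

Lemma csp_phi_weights :
  let w := x * y1 - y in
  let nabla F := 1 / w * total_deriv F in
  let I2 := y2 / w ^+ 3 in
  let I3 := nabla I2 in
  let J := I3 ^+ 2 / I2 ^+ 3 in
  let nabla' F := I2 / I3 * nabla F in
  w != 0 -> y2 != 0 -> I3 != 0 ->
  [/\ forall n, phi (iter n nabla I2) = (jc (h.2 ^+ 2))^-1 ^+ n.+2 * iter n nabla I2,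
      forall F, phi (nabla' F) = nabla' (phi F)
    & phi J = J].
Proof.
move=> w nabla I2 I3 J nabla' w0 y20 I30.
have W0 := prol_w_neq0 hC.
have Dc c := total_deriv_jc c.
have Dx := total_deriv_x.
have Dy := total_deriv_y 0.
have Dy1 := total_deriv_y 1.
have phix : phi x = prol_x h by exact: (csp_phi_var 0).
have phiy : phi y = prol_y h by exact: (csp_phi_var 1).
(* The determinant of the scaled matrix; it is [c^2] because the symplectic factor has determinant
   1. *)
pose E := jc (h.2 * h.1 0 0) * jc (h.2 * h.1 1 1) -
  jc (h.2 * h.1 1 0) * jc (h.2 * h.1 0 1).
have eE : E = jc (h.2 ^+ 2).
  by apply: rmorph_scaled_det; exact: csp_det.
have E0 : E != 0.
  rewrite eE; apply: (rmorph_expf_neq0 jc).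
  by rewrite gt_eqF // csp_scale_gt0.
have iterE := phi_iter_nab (@total_derivD R) (@total_derivM R) csp_phi_chain W0
  (Dc _) (Dc _) (Dc _) (Dc _) Dx Dy Dy1 phix phiy E0 w0.
have nab'E := phi_nab' (@total_derivD R) (@total_derivM R) csp_phi_chain W0
  (Dc _) (Dc _) (Dc _) (Dc _) Dx Dy Dy1 phix phiy E0 w0.
have JE := phi_J (@total_derivD R) (@total_derivM R) csp_phi_chain W0
  (Dc _) (Dc _) (Dc _) (Dc _) Dx Dy Dy1 phix phiy E0 w0.

split.
- move=> n; rewrite -eE; exact: iterE.
- exact: nab'E I30.
- exact: JE y20.
Qed.

End OneElement.

End GroupMorphism.

(** * Generation by the moving frame *)

Section FractionImage.

Variables (P : comNzRingType) (K : fieldType) (s : {rmorphism P -> K}).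
Implicit Types (p q : P) (a b : K).

(** The subfield generated by the image of [s]. For [s = jsub gens] it is the set of rational
    expressions that [freely_generated] asks for. *)
Definition frac_image a := exists p q, s q != 0 /\ a = s p / s q.

Lemma frac_image_morph p : frac_image (s p).
Proof. by exists p, 1; rewrite rmorph1 oner_neq0 divr1. Qed.

Lemma frac_imageD a b : frac_image a -> frac_image b -> frac_image (a + b).
Proof.
move=> [p [q [q0 ->]]] [r [t [t0 ->]]]; exists (p * t + r * q), (q * t).
by rewrite rmorphM mulf_neq0 // addf_div // rmorphD !rmorphM.
Qed.

Lemma frac_imageM a b : frac_image a -> frac_image b -> frac_image (a * b).
Proof.
move=> [p [q [q0 ->]]] [r [t [t0 ->]]]; exists (p * r), (q * t).
by rewrite rmorphM mulf_neq0 // !rmorphM invfM mulrACA.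
Qed.

Lemma frac_imageN a : frac_image a -> frac_image (- a).
Proof. by move=> [p [q [q0 ->]]]; exists (- p), q; rewrite rmorphN mulNr. Qed.

Lemma frac_imageV a : frac_image a -> frac_image a^-1.
Proof.
move=> [p [q [q0 ->]]]; rewrite invf_div.
have [p0|p0] := eqVneq (s p) 0; last by exists q, p.
by rewrite p0 invr0 mulr0; exists 0, 1; rewrite rmorph0 mul0r rmorph1 oner_neq0.
Qed.

Lemma frac_imageX a n : frac_image a -> frac_image (a ^+ n).
Proof.
move=> Ea; elim: n => [|n IHn]; last by rewrite exprS; exact: frac_imageM.
by rewrite expr0 -(rmorph1 s); exact: frac_image_morph.
Qed.

Lemma frac_image_nat n : frac_image n%:R.
Proof. by rewrite -(rmorph_nat s); exact: frac_image_morph. Qed.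

Lemma frac_image_deriv (d : K -> K) a :
  {morph d : b c / b + c} -> (forall b c, leibniz_at d b c) ->
  (forall p, frac_image (d (s p))) -> frac_image a -> frac_image (d a).
Proof.
move=> dD dM ds [p [q [q0 ->]]]; rewrite (derivation_div dM) //.
have Es r := frac_image_morph r.
apply: frac_imageM; last by apply: frac_imageV; exact: frac_imageX.
apply: frac_imageD; first exact: frac_imageM.
by apply: frac_imageN; exact: frac_imageM.
Qed.

Lemma frac_image_fixed (phi : {rmorphism K -> K}) a :
  (forall p, phi (s p) = s p) -> frac_image a -> phi a = a.
Proof. by move=> phis [p [q [q0 ->]]]; rewrite fmorph_div !phis. Qed.

End FractionImage.

Section NormalizedInvariants.

Variables (P : comNzRingType) (K : fieldType) (s : {rmorphism P -> K}).
Variable d : K -> K.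
Hypothesis dD : {morph d : p q / p + q}.
Hypothesis dM : forall p q, leibniz_at d p q.
Variable i0 : K.
Let i1 := d i0.
Hypotheses (i00 : i0 != 0) (i10 : i1 != 0) (two0 : 2%:R != 0 :> K).

Let J := i1 ^+ 2 / i0 ^+ 3.
Let d' F := i0 / i1 * d F.
Let tau := i1 / i0.

Hypothesis EJ : frac_image s J.
Hypothesis Ed' : forall F, frac_image s F -> frac_image s (d' F).

(** The normalized invariant I_(n+2)/tau^(n+2). Under the group [tau] is multiplied by a constant
    and I_(n+2) by its power [n.+2], so the weights cancel. *)
Definition kappa n := iter n d i0 / tau ^+ n.+2.

(** [d'] is [d / tau], so it raises the index by one. The correction comes from differentiating
    [tau ^+ n.+2]; its last factor is [d tau / tau ^+ 2], which equals [kappa 2 * J - 1]. *)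
Let dkappa n : d' (kappa n) =
  kappa n.+1 - n.+2%:R * kappa n * (iter 2 d i0 * i0 / i1 ^+ 2 - 1).
Proof.
have t0 : tau != 0 by rewrite mulf_neq0 ?invr_neq0.
rewrite /d' /kappa (derivation_div dM) ?expf_neq0 // (derivationXS dM).
rewrite [iter n.+1 d i0]iterS.
have -> : d tau = (iter 2 d i0 * i0 - i1 ^+ 2) / i0 ^+ 2.
  by rewrite /tau (derivation_div dM) // /= -/i1 expr2.
move: (iter n d i0) (d _) (iter 2 d i0) => a da i2.
rewrite /tau !expr_div_n !exprS.
field.
by rewrite i00 i10 !expf_neq0.
Qed.

Lemma kappa_frac_image n : frac_image s (kappa n).
Proof.
have k0 : kappa 0 = J^-1 by rewrite /kappa /tau /J /= ; field; rewrite i00 i10.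
have k1 : kappa 1 = J^-1 by rewrite /kappa /tau /J /= -/i1; field; rewrite i00 i10.
have k2 : iter 2 d i0 * i0 / i1 ^+ 2 = kappa 2 * J.
  by rewrite /kappa /tau /J; field; rewrite i00 i10.
have EJV : frac_image s J^-1 by exact: frac_imageV.
have Ek2 : frac_image s (kappa 2).
  (* For n = 1 the recurrence contains [kappa 2] twice, with total coefficient 1 - 3 = -2, since
     [kappa 1 * J = 1]. Hence the division by 2. *)
  have -> : kappa 2 = (3%:R * J^-1 - d' (kappa 1)) / 2%:R.
    have J0 : J != 0 by rewrite /J mulf_neq0 ?invr_neq0 ?expf_neq0.
    by rewrite dkappa k1 k2; field; rewrite J0 two0.
  apply: frac_imageM; last by apply: frac_imageV; exact: frac_image_nat.
  apply: frac_imageD; first by apply: frac_imageM => //; exact: frac_image_nat.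
  by apply: frac_imageN; apply: Ed'; rewrite k1.
elim: n => [|n IHn]; first by rewrite k0.
have -> : kappa n.+1 = d' (kappa n) + n.+2%:R * kappa n * (kappa 2 * J - 1).
  by rewrite dkappa k2 subrK.
apply: frac_imageD; first exact: Ed'.
apply: frac_imageM; first by apply: frac_imageM => //; exact: frac_image_nat.
apply: frac_imageD; first exact: frac_imageM.
by apply: frac_imageN; exact: (frac_image_nat s 1).
Qed.

End NormalizedInvariants.

Lemma nabla_I2_formula (K : fieldType) (d : K -> K) (x y y1 y2 y3 : K) :
  {morph d : a b / a + b} -> (forall a b, leibniz_at d a b) ->
  d x = 1 -> d y = y1 -> d y1 = y2 -> d y2 = y3 ->
  let w := x * y1 - y in w != 0 ->
  1 / w * d (y2 / w ^+ 3) = (y3 * w - 3%:R * x * y2 ^+ 2) / w ^+ 5.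
Proof.
move=> dD dM dx dy dy1 dy2 w w0.
have dw : d w = x * y2 by rewrite /w (derivationB dD) dM dx dy dy1; ring.
by rewrite (derivation_div dM) ?expf_neq0 // (derivationXS dM) dw dy2; field.
Qed.

Section ImageClosure.

Variables (P : comNzRingType) (K : comNzRingType) (s : {rmorphism P -> K}).

Definition in_image (a : K) := exists p, a = s p.

Lemma in_image_morph p : in_image (s p). Proof. by exists p. Qed.

Lemma in_imageD a b : in_image a -> in_image b -> in_image (a + b).
Proof. by move=> [p ->] [q ->]; exists (p + q); rewrite rmorphD. Qed.

Lemma in_imageM a b : in_image a -> in_image b -> in_image (a * b).
Proof. by move=> [p ->] [q ->]; exists (p * q); rewrite rmorphM. Qed.

Lemma in_imageN a : in_image a -> in_image (- a).
Proof. by move=> [p ->]; exists (- p); rewrite rmorphN. Qed.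

Lemma in_imageX a n : in_image a -> in_image (a ^+ n).
Proof. by move=> [p ->]; exists (p ^+ n); rewrite rmorphXn. Qed.

Lemma in_image0 : in_image 0. Proof. by exists 0; rewrite rmorph0. Qed.
Lemma in_image1 : in_image 1. Proof. by exists 1; rewrite rmorph1. Qed.

Lemma in_image_derivD (d : K -> K) p q : {morph d : a b / a + b} ->
  in_image (d (s p)) -> in_image (d (s q)) -> in_image (d (s (p + q))).
Proof. by move=> dD dp dq; rewrite rmorphD dD; exact: in_imageD. Qed.

Lemma in_image_derivM (d : K -> K) p q : (forall a b, leibniz_at d a b) ->
  in_image (d (s p)) -> in_image (d (s q)) -> in_image (d (s (p * q))).
Proof.
move=> dM dp dq; rewrite rmorphM dM.
by apply: in_imageD; apply: in_imageM => //; exact: in_image_morph.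
Qed.

End ImageClosure.

Section InvariantCoordinates.

Variable R : realType.
Implicit Types (p q : polyN R) (F G : jetfun R) (u v : nat -> R).

Local Notation tj := (@to_jetfun R).
Local Notation jc := (@jconst R).
Local Notation x := (jx R).
Local Notation y := (jy R 0).
Local Notation y1 := (jy R 1).
Local Notation y2 := (jy R 2).
Local Notation y3 := (jy R 3).

Definition jw : jetfun R := x * y1 - y.
Definition jnabla F : jetfun R := 1 / jw * total_deriv F.
Definition jI2 : jetfun R := y2 / jw ^+ 3.
Definition iota_ n := iter n jnabla jI2.

(** [wv], [n3v] and [tauv] give the values at a jet of [w], of the numerator of I_3, and of tau =
    I_3/I_2. *)
Definition wv u := u 0%N * u 2%N - u 1%N.
Definition n3v u := u 4 * wv u - 3%:R * u 0%N * u 3 ^+ 2.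
Definition tauv u := n3v u / (wv u ^+ 2 * u 3).

Lemma value_nat n u : has_value (n%:R : jetfun R) u n%:R.
Proof.
elim: n => [|n IHn]; first exact: value0.
by rewrite (mulrSr (1 : jetfun R)) (mulrSr (1 : R)); apply: valueD => //; exact: value1.
Qed.

Lemma jw_value u : has_value jw u (wv u).
Proof.
by apply: valueB; [apply: valueM; [exact: (value_var 0)|exact: (value_var 2)]|
  exact: (value_var 1)].
Qed.

Lemma iota1E : jw != 0 ->
  iota_ 1 = (y3 * jw - 3%:R * x * y2 ^+ 2) / jw ^+ 5.
Proof.
exact: (nabla_I2_formula (@total_derivD R) (@total_derivM R)
  (total_deriv_x R) (total_deriv_y R 0) (total_deriv_y R 1) (total_deriv_y R 2)).
Qed.

Lemma iota0_value u : wv u != 0 -> has_value (iota_ 0) u (u 3 / wv u ^+ 3).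
Proof.
move=> w0; apply: value_div; first exact: (value_var 3).
  by apply: valueX; exact: jw_value.
exact: expf_neq0.
Qed.

Lemma iota1_value u : wv u != 0 -> has_value (iota_ 1) u (n3v u / wv u ^+ 5).
Proof.
move=> w0; rewrite iota1E; last exact: value_neq0 (jw_value u) w0.
apply: value_div; last exact: expf_neq0.
  apply: valueB.
    by apply: valueM; [exact: (value_var 4)|exact: jw_value].
  apply: valueM; last by apply: valueX; exact: (value_var 3).
  by apply: valueM; [exact: value_nat|exact: (value_var 0)].
by apply: valueX; exact: jw_value.
Qed.

Lemma total_deriv_regular F u : (exists c, has_value F u c) ->
  exists c, has_value (total_deriv F) u c.
Proof.
move=> [c /has_valueP[p [q [-> qu _]]]].
have e := jet_deriv_frac (@total_deriv_polyM R) p (ev_neq0 qu).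
have q2 : ev u (q ^+ 2) != 0 by rewrite (rmorphXn (ev u)) expf_neq0.
pose d := total_deriv_poly p * q - p * total_deriv_poly q.
exists (ev u d / ev u (q ^+ 2)); rewrite (total_derivE R) e.
exact: (value_frac d q2).
Qed.

Lemma iota_regular n u : wv u != 0 -> exists c, has_value (iota_ n) u c.
Proof.
move=> w0; elim: n => [|n /total_deriv_regular[c IHn]].
  by exists (u 3 / wv u ^+ 3); exact: iota0_value.
exists (1 / wv u * c); apply: valueM => //; apply: value_div => //.
  exact: value1.
exact: jw_value.
Qed.

(** At this jet [w] and [y2] equal 1 and the numerator of I_3 is 4 - 3 = 1, so it witnesses that
    these functions are not zero. *)
Definition base_jet : nat -> R := fun i => nth 0 [:: 1; 0; 1; 1; 4%:R] i.

Lemma jw_neq0 : jw != 0.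
Proof.
apply: value_neq0 (jw_value base_jet) _.
by rewrite /wv /base_jet /= mulr1 subr0 oner_neq0.
Qed.

Lemma y2_neq0 : y2 != 0.
Proof.
apply: (value_neq0 (u := base_jet)); first exact: (value_var 3).
by rewrite /base_jet /= oner_neq0.
Qed.

Lemma iota1_neq0 : iota_ 1 != 0.
Proof.
have w1 : wv base_jet = 1 by rewrite /wv /base_jet /= mulr1 subr0.
have w0 : wv base_jet != 0 by rewrite w1 oner_neq0.
apply: value_neq0 (iota1_value w0) _.
rewrite /n3v w1 expr1n divr1 /base_jet /= !mulr1 expr1n mulr1.
by rewrite (_ : 4%:R - 3%:R = 1) ?oner_neq0 //; ring.
Qed.

Lemma iota0_neq0 : iota_ 0 != 0.
Proof.
have w1 : wv base_jet = 1 by rewrite /wv /base_jet /= mulr1 subr0.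
have w0 : wv base_jet != 0 by rewrite w1 oner_neq0.
apply: value_neq0 (iota0_value w0) _.
by rewrite w1 expr1n divr1 /base_jet /= oner_neq0.
Qed.

(** The coordinates x, y, y_1, I_2, I_3, and so on: the variable [k.+3], which is y_(k+2), is
    replaced by I_(k+2). *)
Definition inv_coord (i : nat) : jetfun R :=
  if i is k.+3 then iota_ k else tj (varN R i).

Lemma inv_coord_value u (c : nat -> R) i :
  (forall k, has_value (iota_ k) u (c k)) ->
  has_value (inv_coord i) u (if i is k.+3 then c k else u i).
Proof. by move=> uc; case: i => [|[|[|k]]]; [exact: value_var..|exact: uc]. Qed.

Lemma field_cancel (K : fieldType) (w a : K) : w != 0 -> a = w * (1 / w * a).
Proof. by move=> w0; field. Qed.

Lemma field_divX (K : fieldType) (w a : K) n : w != 0 -> a = a / w ^+ n * w ^+ n.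
Proof. by move=> w0; rewrite divfK // expf_neq0. Qed.

(** The ring contains [w], hence it is stable under [D_x]: the derivative of I_k is [w] times
    I_(k+1), and that of y_1 is [y2], which equals I_2 times [w^3]. *)
Lemma inv_coord_gen i : in_image (jsub inv_coord) (tj (varN R i)).
Proof.
have Iv k : in_image (jsub inv_coord) (inv_coord k).
  by exists (varN R k); exact: (esym (jsub_var _ _)).
have Iw : in_image (jsub inv_coord) jw.
  apply: in_imageD; last by apply: in_imageN; exact: (Iv 1).
  by apply: in_imageM; [exact: (Iv 0)|exact: (Iv 2)].
have ID p : in_image (jsub inv_coord) (total_deriv (jsub inv_coord p)).
  elim/polyN_ind: p => [c|k|p q Hp Hq|p q Hp Hq].
  - rewrite jsub_const (total_deriv_jc c); exact: in_image0.
  - rewrite jsub_var; case: k => [|[|[|k]]].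
    + rewrite (total_deriv_x R : total_deriv (inv_coord 0) = 1); exact: in_image1.
    + rewrite (total_deriv_y R 0 : total_deriv (inv_coord 1) = y1); exact: (Iv 2).
    + rewrite (total_deriv_y R 1 : total_deriv (inv_coord 2) = y2).
      rewrite (field_divX y2 3 jw_neq0).
      by apply: in_imageM; [exact: (Iv 3)|exact: in_imageX].
    + rewrite (field_cancel (total_deriv (inv_coord k.+3)) jw_neq0).
      by apply: in_imageM => //; exact: (Iv k.+4).
  - exact: (in_image_derivD (s := jsub inv_coord) (@total_derivD R) Hp Hq).
  - exact: (in_image_derivM (s := jsub inv_coord) (@total_derivM R) Hp Hq).
case: i => [|l]; first exact: (Iv 0).
elim: l => [|l [p e]]; first exact: (Iv 1).
rewrite -(total_deriv_y R l : total_deriv (tj (varN R l.+1)) = tj (varN R l.+2)) e.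
exact: ID.
Qed.

Definition coord_poly i : polyN R := projT1 (cid (inv_coord_gen i)).

Lemma coord_polyE i : tj (varN R i) = jsub inv_coord (coord_poly i).
Proof. by rewrite /coord_poly; case: cid. Qed.

(** A jet is reconstructed polynomially from its base point, its direction and the values of its
    invariants. *)
Lemma coord_poly_ev u (c : nat -> R) i :
  (forall k, has_value (iota_ k) u (c k)) ->
  u i = ev (fun i => if i is k.+3 then c k else u i) (coord_poly i).
Proof.
move=> uc; apply: value_unique (value_var i u) _.
rewrite coord_polyE; apply: jsub_value => k; exact: inv_coord_value.
Qed.

End InvariantCoordinates.

Section ScaledDerivation.

Variables (K : fieldType) (g : K) (d : K -> K).
Hypothesis dD : {morph d : a b / a + b}.
Hypothesis dM : forall a b, leibniz_at d a b.

Lemma scaled_derivD : {morph (fun F => g * d F) : a b / a + b}.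
Proof. by move=> a b /=; rewrite dD mulrDr. Qed.

Lemma scaled_derivM a b : leibniz_at (fun F => g * d F) a b.
Proof. by rewrite /leibniz_at dM; ring. Qed.

End ScaledDerivation.

Section FracImageDerivation.

Variables (P : comNzRingType) (K : fieldType) (s : {rmorphism P -> K}) (d : K -> K).
Hypothesis dD : {morph d : a b / a + b}.
Hypothesis dM : forall a b, leibniz_at d a b.
Local Notation E := (frac_image s).

Lemma frac_image_derivD p q : E (d (s p)) -> E (d (s q)) -> E (d (s (p + q))).
Proof. by move=> dp dq; rewrite rmorphD dD; exact: frac_imageD. Qed.

Lemma frac_image_derivM p q : E (d (s p)) -> E (d (s q)) -> E (d (s (p * q))).
Proof.
move=> dp dq; rewrite rmorphM dM.
by apply: frac_imageD; apply: frac_imageM => //; exact: frac_image_morph.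
Qed.

End FracImageDerivation.

Section FracImageSubst.

Variables (P Q : comNzRingType) (K : fieldType).
Variables (s : {rmorphism P -> K}) (t : {rmorphism Q -> K}).
Local Notation E := (frac_image s).

Lemma frac_image_substD p q : E (t p) -> E (t q) -> E (t (p + q)).
Proof. by move=> dp dq; rewrite rmorphD; exact: frac_imageD. Qed.

Lemma frac_image_substM p q : E (t p) -> E (t q) -> E (t (p * q)).
Proof. by move=> dp dq; rewrite rmorphM; exact: frac_imageM. Qed.

End FracImageSubst.

Section MovingFrame.

Variable R : realType.
Implicit Types (p q : polyN R) (F G : jetfun R) (u v : nat -> R).

Local Notation tj := (@to_jetfun R).
Local Notation jc := (@jconst R).
Local Notation iota_ := (@iota_ R).

Definition jJ : jetfun R := iota_ 1 ^+ 2 / iota_ 0 ^+ 3.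
Definition jnab' F : jetfun R := iota_ 0 / iota_ 1 * jnabla F.
Definition gens j := iter j jnab' jJ.
Local Notation E := (frac_image (jsub gens)).

Lemma jnablaD : {morph @jnabla R : F G / F + G}.
Proof. exact: (scaled_derivD _ (@total_derivD R)). Qed.

Lemma jnablaM F G : leibniz_at (@jnabla R) F G.
Proof. exact: (scaled_derivM _ (@total_derivM R)). Qed.

Lemma jnab'D : {morph jnab' : F G / F + G}.
Proof. exact: (scaled_derivD _ jnablaD). Qed.

Lemma jnab'M F G : leibniz_at jnab' F G.
Proof. exact: (scaled_derivM _ jnablaM). Qed.

Lemma mul_mul0 (K : fieldType) (a b c : K) : c = 0 -> a * (b * c) = 0.
Proof. by move=> ->; rewrite !mulr0. Qed.

Lemma jnab'_jc c : jnab' (jc c) = 0.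
Proof. exact: (mul_mul0 _ _ (total_deriv_jc c)). Qed.

Lemma E_gen j : E (gens j).
Proof. by rewrite -(jsub_var gens j); exact: (frac_image_morph (jsub gens)). Qed.

Lemma E_const c : E (jc c).
Proof. by rewrite -(jsub_const gens c); exact: (frac_image_morph (jsub gens)). Qed.

(** The derivation maps each generator to the next and kills constants, so it preserves the field
    they generate. *)
Lemma E_nab' F : E F -> E (jnab' F).
Proof.
have Enab p : E (jnab' (jsub gens p)).
  elim/polyN_ind: p => [c|j|p q Hp Hq|p q Hp Hq].
  - rewrite jsub_const jnab'_jc; exact: (frac_image_nat _ 0).
  - rewrite jsub_var; exact: (E_gen j.+1).
  - exact: (frac_image_derivD (s := jsub gens) jnab'D Hp Hq).
  - exact: (frac_image_derivM (s := jsub gens) jnab'M Hp Hq).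
exact: (frac_image_deriv jnab'D jnab'M Enab).
Qed.

Lemma E_subst V p : (forall i, E (V i)) -> E (jsub V p).
Proof.
move=> EV; elim/polyN_ind: p => [c|j|p q Hp Hq|p q Hp Hq].
- rewrite jsub_const; exact: E_const.
- by rewrite jsub_var.
- exact: (frac_image_substD (t := jsub V) Hp Hq).
- exact: (frac_image_substM (t := jsub V) Hp Hq).
Qed.

Lemma jetfun_two_neq0 : (2%:R : jetfun R) != 0.
Proof.
by apply: value_neq0 (value_nat 2 (fun=> 0)) _; rewrite pnatr_eq0.
Qed.

Definition jkappa : nat -> jetfun R := kappa (@jnabla R) (jI2 R).

Lemma jkappaE n : jkappa n = iota_ n / (iota_ 1 / iota_ 0) ^+ n.+2.
Proof. exact: erefl. Qed.

Lemma E_jkappa n : E (jkappa n).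
Proof.
have EJ : E (jnabla (jI2 R) ^+ 2 / jI2 R ^+ 3) := E_gen 0.
have Enab F : E F -> E (jI2 R / jnabla (jI2 R) * jnabla F) := @E_nab' F.
exact: (kappa_frac_image jnablaM (iota0_neq0 R) (iota1_neq0 R)
  jetfun_two_neq0 EJ Enab n).
Qed.

(** Rescaling so that tau becomes tau(b) turns I_(k+2) into (tau(b)/tau)^(k+2) I_(k+2), which is a
    constant times [jkappa k]. *)
Definition frame_coord (b : nat -> R) (i : nat) : jetfun R :=
  if i is k.+3 then jc (tauv b ^+ k.+2) * jkappa k else jc (b i).

Definition frame_var b i := jsub (frame_coord b) (coord_poly R i).

Lemma E_frame_var b i : E (frame_var b i).
Proof.
apply: E_subst => -[|[|[|k]]]; do ?exact: E_const.
apply: frac_imageM; [exact: E_const|exact: E_jkappa].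
Qed.

Lemma tau_ratio (n3 w u3 : R) : w != 0 -> u3 != 0 ->
  n3 / w ^+ 5 / (u3 / w ^+ 3) = n3 / (w ^+ 2 * u3).
Proof. by move=> w0 u30; field; rewrite w0 u30. Qed.

Lemma jkappa_value u c k : wv u != 0 -> u 3 != 0 -> n3v u != 0 ->
  has_value (iota_ k) u c -> has_value (jkappa k) u (c / tauv u ^+ k.+2).
Proof.
move=> w0 u30 n0 uc.
have i00 : u 3 / wv u ^+ 3 != 0 by rewrite mulf_neq0 ?invr_neq0 ?expf_neq0.
rewrite jkappaE; apply: value_div => //; last first.
  by rewrite expf_neq0 // /tauv mulf_neq0 // invr_neq0 // mulf_neq0 // expf_neq0.
rewrite /tauv -tau_ratio //; apply: valueX.
by apply: value_div => //; [exact: iota1_value|exact: iota0_value].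
Qed.

(* frame_var b takes u to the jet v over the base point and direction of b whose *)
(* invariants iota_ k are those of u, rescaled so that tau agrees with b.        *)
Lemma frame_var_value b u v (c c' : nat -> R) i :
  wv u != 0 -> u 3 != 0 -> n3v u != 0 ->
  (forall k, has_value (iota_ k) u (c k)) ->
  (forall k, has_value (iota_ k) v (c' k)) ->
  v 0%N = b 0%N -> v 1%N = b 1%N -> v 2%N = b 2%N ->
  (forall k, c' k = (tauv b / tauv u) ^+ k.+2 * c k) ->
  has_value (frame_var b i) u (v i).
Proof.
move=> w0 u30 n0 uc vc v0 v1 v2 cc'.
rewrite (coord_poly_ev i vc); apply: jsub_value => -[|[|[|k]]].
- by rewrite v0; exact: value_const.
- by rewrite v1; exact: value_const.
- by rewrite v2; exact: value_const.
rewrite cc' expr_div_n mulrAC -mulrA.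
apply: valueM; first exact: value_const.
exact: jkappa_value.
Qed.

End MovingFrame.

Section FrameElement.

Variable R : realType.
Implicit Types (u b : nat -> R) (c : R).

(* With scale c it takes the base point p and the tangent direction of u to those *)
(* of b: in the frames (p, q) at u and b, where q is tangent and omega p q = 1,    *)
(* it is diag(1/c, c).                                                            *)
Definition frame_mx b u c : 'M[R]_2 := \matrix_(i, j)
  (if i == 0 then
     if j == 0 then b 0%N * u 2%N / (c * wv u) - c * u 1%N / wv b
     else c * u 0%N / wv b - b 0%N / (c * wv u)
   else
     if j == 0 then b 1%N * u 2%N / (c * wv u) - c * b 2%N * u 1%N / wv b
     else c * b 2%N * u 0%N / wv b - b 1%N / (c * wv u)).

Lemma frame_mxE b u c :
  [/\ frame_mx b u c 0 0 = b 0%N * u 2%N / (c * wv u) - c * u 1%N / wv b,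
      frame_mx b u c 0 1 = c * u 0%N / wv b - b 0%N / (c * wv u),
      frame_mx b u c 1 0 = b 1%N * u 2%N / (c * wv u) - c * b 2%N * u 1%N / wv b
    & frame_mx b u c 1 1 = c * b 2%N * u 0%N / wv b - b 1%N / (c * wv u)].
Proof. by split; rewrite mxE. Qed.

Variables (b u : nat -> R) (c : R).
Hypotheses (c0 : 0 < c) (wu : wv u != 0) (wb : wv b != 0).
Let h := (frame_mx b u c, c).

Let cn0 : c != 0. Proof. exact: lt0r_neq0. Qed.

Lemma frame_csp : CSp2 h.
Proof.
split=> //=; apply/Sp2P; rewrite /det2; have [-> -> -> ->] := frame_mxE b u c.
move: wu wb; rewrite /wv => wu' wb'; field.
by rewrite wu' wb' cn0.
Qed.

Lemma frame_wval : wval h u = c ^+ 2 * wv u / wv b.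
Proof.
rewrite /wval /=; have [-> -> _ _] := frame_mxE b u c.
move: wu wb; rewrite /wv => wu' wb'; field.
by rewrite wu' wb' cn0.
Qed.

Lemma frame_wval_neq0 : wval h u != 0.
Proof. by rewrite frame_wval mulf_neq0 ?invr_neq0 // mulf_neq0 // expf_neq0. Qed.

Lemma frame_x : c * frame_mx b u c 0 0 * u 0%N + c * frame_mx b u c 0 1 * u 1%N = b 0%N.
Proof.
have [-> -> _ _] := frame_mxE b u c.
move: wu wb; rewrite /wv => wu' wb'; field.
by rewrite wu' wb' cn0.
Qed.

Lemma frame_y : c * frame_mx b u c 1 0 * u 0%N + c * frame_mx b u c 1 1 * u 1%N = b 1%N.
Proof.
have [_ _ -> ->] := frame_mxE b u c.
move: wu wb; rewrite /wv => wu' wb'; field.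
by rewrite wu' wb' cn0.
Qed.

Lemma frame_y1 :
  (c * frame_mx b u c 1 0 + c * frame_mx b u c 1 1 * u 2%N) / wval h u = b 2%N.
Proof.
rewrite frame_wval; have [_ _ -> ->] := frame_mxE b u c.
move: wu wb; rewrite /wv => wu' wb'; field.
by rewrite wu' wb' cn0.
Qed.

Lemma frame_prolong v : prolong h u v ->
  [/\ v 0%N = b 0%N, v 1%N = b 1%N & v 2%N = b 2%N].
Proof.
move=> uv; have V i := prolong_value i frame_csp uv.
have vx : has_value (jx R) u (u 0%N) := value_var 0 u.
have vy : has_value (jy R 0) u (u 1%N) := value_var 1 u.
have vy1 : has_value (jy R 1) u (u 2%N) := value_var 2 u.
have vc d : has_value (jconst d) u d := value_const d u.
split.
- rewrite -frame_x; apply: value_unique (V 0%N) _.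
  by apply: valueD; exact: valueM.
- rewrite -frame_y; apply: value_unique (V 1%N) _.
  by apply: valueD; exact: valueM.
rewrite -frame_y1; apply: value_unique (V 2%N) _.
apply: value_div; last exact: frame_wval_neq0; last exact: prol_w_value.
have -> : total_deriv (prol_y h) =
    jconst (c * frame_mx b u c 1 0) + jconst (c * frame_mx b u c 1 1) * jy R 1.
  exact: (derivation_affine (@total_derivD R) (@total_derivM R)
    (total_deriv_jc _) (total_deriv_jc _) (total_deriv_x R) (total_deriv_y R 0)).
by apply: valueD => //; exact: valueM.
Qed.

End FrameElement.

Section Generation.

Variable R : realType.
Implicit Types (p q : polyN R) (F G : jetfun R) (u v b : nat -> R).

Local Notation tj := (@to_jetfun R).
Local Notation jc := (@jconst R).
Local Notation iota_ := (@iota_ R).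
Local Notation E := (frac_image (jsub (gens R))).

Definition wP : polyN R := varN R 0 * varN R 2 - varN R 1.
Definition n3P : polyN R := varN R 4 * wP - constN 3%:R * varN R 0 * varN R 3 ^+ 2.

Lemma rmorph_wP (P : comNzRingType) (e : {rmorphism P -> R}) (x0 x1 x2 : P) a0 a1 a2 :
  e x0 = a0 -> e x1 = a1 -> e x2 = a2 -> e (x0 * x2 - x1) = a0 * a2 - a1.
Proof. by move=> <- <- <-; rewrite rmorphB rmorphM. Qed.

Lemma rmorph_n3P (P : comNzRingType) (e : {rmorphism P -> R}) (x4 w k x0 x3 : P)
    a4 aw ak a0 a3 :
  e x4 = a4 -> e w = aw -> e k = ak -> e x0 = a0 -> e x3 = a3 ->
  e (x4 * w - k * x0 * x3 ^+ 2) = a4 * aw - ak * a0 * a3 ^+ 2.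
Proof.
move=> <- <- <- <- <-; rewrite rmorphB [e (x4 * w)]rmorphM.
by rewrite [e (_ * x3 ^+ 2)]rmorphM [e (k * x0)]rmorphM rmorphXn.
Qed.

Lemma ev_wP u : ev u wP = wv u.
Proof. exact: (rmorph_wP (e := ev u) (ev_var _ _) (ev_var _ _) (ev_var _ _)). Qed.

Lemma ev_n3P u : ev u n3P = n3v u.
Proof.
exact: (rmorph_n3P (e := ev u) (ev_var _ _) (ev_wP u) (ev_const _ _)
  (ev_var _ _) (ev_var _ _)).
Qed.

Lemma generic_neq0 : wP * (varN R 3 * n3P) != 0.
Proof.
have w1 : wv (base_jet R) = 1 by rewrite /wv /base_jet /= mulr1 subr0.
have n1 : n3v (base_jet R) = 1 by rewrite /n3v w1 /base_jet /=; ring.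
have y1 : base_jet R 3 = 1 by [].
apply: (@ev_neq0 _ (base_jet R)).
by rewrite !evM_neq0 ev_wP ev_n3P ev_var w1 n1 y1 oner_neq0.
Qed.

(** [tau] has the sign of the numerator of I_3 times [y2], because [w] enters it only through its
    square. *)
Lemma tauv_ratio_gt0 u b : wv u != 0 -> wv b != 0 ->
  0 < n3v u * u 3 * (n3v b * b 3) -> 0 < tauv u / tauv b.
Proof.
rewrite /tauv; move: (n3v u) (n3v b) (u 3) (b 3) (wv u) (wv b) => n m s t w z.
move=> w0 z0 pos.
have [n0 s0 m0 t0] : [/\ n != 0, s != 0, m != 0 & t != 0].
  by move: (lt0r_neq0 pos); rewrite !mulf_eq0 !negb_or -!andbA => /and4P[].
have -> : n / (w ^+ 2 * s) / (m / (z ^+ 2 * t)) =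
    n * s * (m * t) * (z / (w * s * m)) ^+ 2 by field; rewrite w0 s0 m0 t0 z0.
apply: mulr_gt0 => //; rewrite exprn_even_gt0 //=.
by rewrite mulf_neq0 // invr_neq0 // !mulf_neq0.
Qed.

Lemma iota_values u : wv u != 0 -> exists c, forall k, has_value (iota_ k) u (c k).
Proof.
by move=> w0; exists (fun k => projT1 (cid (iota_regular k w0))) => k; case: cid.
Qed.

Lemma frame_var_base b i : wv b != 0 -> b 3 != 0 -> n3v b != 0 ->
  has_value (frame_var b i) b (b i).
Proof.
move=> w0 b30 n0; have [c bc] := iota_values w0.
apply: (frame_var_value (c := c) (c' := c)) => // k.
rewrite divff ?expr1n ?mul1r //.
by rewrite /tauv mulf_neq0 // invr_neq0 // mulf_neq0 // expf_neq0.
Qed.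

(** The matrix matches base point and direction and the scale matches tau. The weights then give all
    the remaining invariants of the image, which is thus the jet described by [frame_var]. *)
Lemma frame_orbit b u : finite_jet u -> wv u != 0 -> wv b != 0 ->
  0 < n3v u * u 3 * (n3v b * b 3) ->
  exists2 v, same_orbit u v & forall i, has_value (frame_var b i) u (v i).
Proof.
move=> ufin wu wb pos.
have [nu0 u30 nb0 b30] : [/\ n3v u != 0, u 3 != 0, n3v b != 0 & b 3 != 0].
  by move: (lt0r_neq0 pos); rewrite !mulf_eq0 !negb_or -!andbA => /and4P[].
have tpos := tauv_ratio_gt0 wu wb pos.
(* A group element of scale [c] multiplies tau by [c^-2], so reaching [tauv b] forces this value. *)
pose c := Num.sqrt (tauv u / tauv b).
have c0 : 0 < c by rewrite sqrtr_gt0.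
have c2 : c ^+ 2 = tauv u / tauv b by rewrite sqr_sqrtr // ltW.
pose h := (frame_mx b u c, c).
have hC : CSp2 h := frame_csp c0 wu wb.
have [v [uv _]] := prolong_exists hC ufin (frame_wval_neq0 c0 wu wb).
have [v0 v1 v2] := frame_prolong c0 wu wb uv.
have wv0 : wv v != 0 by rewrite /wv v0 v1 v2.
have [d ud] := iota_values wu; have [d' vd'] := iota_values wv0.
exists v; first by exists h.
have [phi phiE] := csp_morphism hC.
have iotaE n : phi (iota_ n) = (jc (c ^+ 2))^-1 ^+ n.+2 * iota_ n.
  have [H _ _] := csp_phi_weights hC phiE (jw_neq0 R) (y2_neq0 R) (iota1_neq0 R).
  exact: H.
move=> i; apply: (frame_var_value (c := d) (c' := d')) => // k.
have vk := csp_phi_value hC phiE uv (vd' k).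
have -> : tauv b / tauv u = (c ^+ 2)^-1 by rewrite c2 [RHS]invf_div.
rewrite iotaE in vk; apply: value_unique vk _.
apply: valueM => //; apply: valueX; apply: valueV; first exact: value_const.
by rewrite expf_neq0 // gt_eqF.
Qed.

Theorem invariant_generated F : differential_invariant F -> E F.
Proof.
move=> Finv; have [p [q [q0 eF]]] := jetfun_div F.
(* The frame is anchored at a finite jet where [w], [y2], the numerator of I_3 and the denominator
   of [F] are all nonzero. *)
have [b qb bfin] := ev_neq0_exists (mulf_neq0 q0 generic_neq0).
move: qb; rewrite !evM_neq0 ev_wP ev_n3P ev_var => /and4P[qb wb b30 nb0].
pose V := frame_var b.
(* The frame takes [b] to itself, so the substituted denominator has at [b] the value of [q]
   there. *)
have qV0 : jsub V q != 0.
  apply: value_neq0 qb; apply: jsub_value => i; exact: frame_var_base.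
have EG : E (jsub V p / jsub V q).
  apply: frac_imageM; last apply: frac_imageV.
    by apply: E_subst => i; exact: E_frame_var.
  by apply: E_subst => i; exact: E_frame_var.
suff -> : F = jsub V p / jsub V q by exact: EG.
have [N N0 VN] := jetfun_neq0_ev qV0.
(* Where [w] is nonzero, positivity of [M] says that tau has the same sign as at [b]. At [b] itself
   [M] is the square of a nonzero number. *)
pose M := n3P * varN R 3 * constN (n3v b * b 3).
have evM u : ev u M = n3v u * u 3 * (n3v b * b 3).
  apply: etrans (rmorphM (ev u) _ _) (congr2 *%R _ (ev_const u _)).
  exact: etrans (rmorphM (ev u) _ _) (congr2 *%R (ev_n3P u) (ev_var u 3)).
have Mb : 0 < ev b M.
  by rewrite evM -expr2 exprn_even_gt0 //= mulf_neq0.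
have NN0 : N * (q * wP) != 0.
  apply: mulf_neq0 => //; apply: mulf_neq0 => //.
  by apply: (@ev_neq0 _ b); rewrite ev_wP.
apply: (value_density bfin Mb NN0) => u ufin Mu0.
have {Mu0} Mu := eq_ind _ (fun z => 0 < z) Mu0 _ (evM u).
rewrite (evM_neq0 u N) (evM_neq0 u q) ev_wP => /and3P[/VN[c1 qc c10] qu wu].
have [v uv Vv] := frame_orbit ufin wu wb Mu.
have qv := jsub_value q Vv; have pv := jsub_value p Vv.
have qv0 : ev v q != 0 by rewrite -(value_unique qc qv).
have Fu : has_value F u (ev u p / ev u q) by rewrite eF; exact: value_frac.
have Fv : has_value F v (ev v p / ev v q) by rewrite eF; exact: value_frac.
exists (ev u p / ev u q) => //.
by rewrite (Finv u v uv _ _ Fu Fv); exact: value_div pv qv qv0.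
Qed.

End Generation.

(** * Algebraic independence *)

Section DerivationKernel.

Variables (K : fieldType) (d : K -> K).
Hypothesis dD : {morph d : a b / a + b}.
Hypothesis dM : forall a b, leibniz_at d a b.

Lemma dkerD a b : d a = 0 -> d b = 0 -> d (a + b) = 0.
Proof. by move=> da db; rewrite dD da db addr0. Qed.

Lemma dkerM a b : d a = 0 -> d b = 0 -> d (a * b) = 0.
Proof. by move=> da db; rewrite dM da db mul0r mulr0 addr0. Qed.

Lemma dker1 : d 1 = 0. Proof. exact: derivation1 dM. Qed.

Lemma dkerV a : d a = 0 -> d a^-1 = 0.
Proof.
have [->|a0] := eqVneq a 0; first by rewrite invr0.
by move=> da; rewrite (derivationV dM) // da oppr0 mul0r.
Qed.

Lemma dkerX a n : d a = 0 -> d (a ^+ n) = 0.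
Proof.
move=> da; elim: n => [|n IHn]; last by rewrite exprS; exact: dkerM.
by rewrite expr0 dker1.
Qed.

Lemma dkerN a : d a = 0 -> d (- a) = 0.
Proof. by move=> da; rewrite (derivationN dD) da oppr0. Qed.

Variables (x y y1 y2 y3 : K).
Hypotheses (dx : d x = 0) (dy : d y = 0) (dy1 : d y1 = 0) (dy2 : d y2 = 0).
Let w := x * y1 - y.
Let i0 := y2 / w ^+ 3.
Let i1 := (y3 * w - 3%:R * x * y2 ^+ 2) / w ^+ 5.
Hypotheses (w0 : w != 0) (i00 : i0 != 0) (i10 : i1 != 0).

Lemma dker_nat n : d n%:R = 0.
Proof.
elim: n => [|n IHn]; first exact: derivation0 dD.
by rewrite mulrSr; apply: dkerD => //; exact: dker1.
Qed.

Let dw : d w = 0.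
Proof. by apply: dkerD; [exact: dkerM|exact: dkerN]. Qed.

Lemma dker_i0 : d i0 = 0.
Proof. by apply: dkerM => //; apply: dkerV; exact: dkerX. Qed.

(** [y3] enters I_3 linearly with coefficient [w / w^5]; everything else in I_3 is killed by [d]. *)
Let di1 : d i1 = d y3 / w ^+ 4.
Proof.
rewrite /i1 (derivation_div dM) ?expf_neq0 // (dkerX 5 dw).
rewrite dD (dM y3) dw (dkerN _); first by field.
by apply: dkerM; [apply: dkerM => //; exact: dker_nat|exact: dkerX].
Qed.

Lemma dker_i1 : d y3 = 0 -> d i1 = 0.
Proof. by move=> d3; rewrite di1 d3 mul0r. Qed.

Lemma dker_J : d y3 = 0 -> d (i1 ^+ 2 / i0 ^+ 3) = 0.
Proof.
move=> d3; apply: dkerM; first by apply: dkerX; exact: dker_i1.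
by apply: dkerV; apply: dkerX; exact: dker_i0.
Qed.

Lemma dJ_neq0 : 2%:R != 0 :> K -> d y3 = 1 -> d (i1 ^+ 2 / i0 ^+ 3) != 0.
Proof.
move=> two0 d3; rewrite dM (dkerV (dkerX 3 dker_i0)) mulr0 addr0.
rewrite (derivationXS dM) expr1 di1 d3 div1r.
have V n (a : K) : a != 0 -> (a ^+ n)^-1 != 0 by move=> a0; rewrite invr_eq0 expf_eq0 (negPf a0) andbF.
apply: mulf_neq0 (V 3 _ i00).
by apply: mulf_neq0; [exact: mulf_neq0|exact: V].
Qed.

(* i0 / i1 * (1 / w) is the coefficient of D_x in the invariant derivation. *)
Lemma dker_factor : d y3 = 0 -> d (i0 / i1 * (1 / w)) = 0.
Proof.
move=> d3; apply: dkerM.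
  by apply: dkerM; [exact: dker_i0|apply: dkerV; exact: dker_i1].
by apply: dkerM; [exact: dker1|exact: dkerV].
Qed.

End DerivationKernel.

Section ChainSum.

Variables (P : comNzRingType) (K : fieldType) (s : {rmorphism P -> K}).
Variables (d : K -> K) (pd : nat -> P -> P) (V : nat -> K).
Hypothesis dD : {morph d : a b / a + b}.
Hypothesis dM : forall a b, leibniz_at d a b.
Hypothesis pdD : forall j, {morph pd j : p q / p + q}.
Hypothesis pdM : forall j p q, leibniz_at (pd j) p q.

(** The chain rule for a polynomial in the [V j], truncated to the first [n] of them. *)
Definition chain_sum p n := d (s p) = \sum_(j < n) s (pd j p) * d (V j).

Lemma chain_sumD p q n : chain_sum p n -> chain_sum q n -> chain_sum (p + q) n.
Proof.
rewrite /chain_sum => dp dq; rewrite rmorphD dD dp dq -big_split /=.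
by apply: eq_bigr => j _; rewrite pdD rmorphD mulrDl.
Qed.

Lemma chain_sumM p q n : chain_sum p n -> chain_sum q n -> chain_sum (p * q) n.
Proof.
rewrite /chain_sum => dp dq; rewrite rmorphM dM dp dq.
rewrite mulr_suml mulr_sumr -big_split /=.
by apply: eq_bigr => j _; rewrite pdM rmorphD !rmorphM; ring.
Qed.

Lemma chain_sum0 p n : d (s p) = 0 -> (forall j, pd j p = 0) -> chain_sum p n.
Proof.
rewrite /chain_sum => -> pd0; rewrite big1 // => j _.
by rewrite pd0 rmorph0 mul0r.
Qed.

Lemma chain_sum_var p i n : (i < n)%N -> s p = V i ->
  (forall j, pd j p = (j == i)%:R) -> chain_sum p n.
Proof.
rewrite /chain_sum => ltin -> pdp.
rewrite (sum_ord_single (F := fun j => s (pd j p) * d (V j)) ltin).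
  by rewrite pdp eqxx rmorph1 mul1r.
by move=> l /negPf li; rewrite pdp li rmorph0 mul0r.
Qed.

(** Below [i] the factors [d (V j)] vanish and above [i] the partial derivatives of [p] do. The
    single remaining term has the nonzero factor [d (V i)]. *)
Lemma chain_sum_top p i n : (i < n)%N -> chain_sum p n -> s p = 0 ->
  (forall j, (i < j)%N -> pd j p = 0) -> (forall j, (j < i)%N -> d (V j) = 0) ->
  d (V i) != 0 -> s (pd i p) = 0.
Proof.
rewrite /chain_sum => ltin e sp0 hi lo top; move: e.
rewrite sp0 (derivation0 dD).
rewrite (sum_ord_single (F := fun j => s (pd j p) * d (V j)) ltin).
  by move/esym/eqP; rewrite mulf_eq0 (negPf top) orbF => /eqP.
move=> l; rewrite neq_ltn => /orP[/lo ->|/hi ->]; first by rewrite mulr0.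
by rewrite rmorph0 mul0r.
Qed.

End ChainSum.

Lemma bracket_step (K : fieldType) (d D f : K -> K) (m F : K) :
  (forall a b, leibniz_at d a b) -> d m = 0 -> bracket_at d D f F ->
  d F = 0 -> D 0 = 0 -> d (m * D F) = m * f F.
Proof.
by rewrite /bracket_at => dM dm dDF dF D0; rewrite dM dm dDF dF D0; ring.
Qed.

Section Freeness.

Variable R : realType.
Implicit Types (p q : polyN R) (F G : jetfun R).

Local Notation gens := (gens R).
Local Notation jp := (@jet_partial R).

Lemma jet_partial_var_eq0 m i : m != i -> jp m (to_jetfun (varN R i)) = 0.
Proof. by move=> mi; rewrite jet_partial_var (negPf mi). Qed.

Let dvar m i : (i < m)%N -> jp m (to_jetfun (varN R i)) = 0.
Proof. by move=> im; apply: jet_partial_var_eq0; rewrite gtn_eqF. Qed.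

Lemma jet_partial_x m : (0 < m)%N -> jp m (jx R) = 0.
Proof. exact: (@dvar m 0). Qed.

Lemma jet_partial_y m l : (l.+1 < m)%N -> jp m (jy R l) = 0.
Proof. exact: (@dvar m l.+1). Qed.

Definition jfactor : jetfun R := iota_ R 0 / iota_ R 1 * (1 / jw R).

Lemma gensS n : gens n.+1 = jfactor * total_deriv (gens n).
Proof. exact: mulrA. Qed.

Lemma jfactor_neq0 : jfactor != 0.
Proof.
apply: mulf_neq0; apply: mulf_neq0; rewrite ?invr_eq0 ?oner_neq0 //.
- exact: iota0_neq0.
- exact: iota1_neq0.
- exact: jw_neq0.
Qed.

Lemma jet_partial_factor m : (4 < m)%N -> jp m jfactor = 0.
Proof.
move=> m4; rewrite /jfactor (iota1E (jw_neq0 R)).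
have dx : jp m (jx R) = 0 := jet_partial_x (leq_trans (isT : 1 <= 5)%N m4).
have dy l : (l < 4)%N -> jp m (jy R l) = 0.
  by move=> l4; apply: jet_partial_y; exact: leq_ltn_trans l4 m4.
exact: (dker_factor (@jet_partialD R m) (@jet_partialM R m) dx
  (dy 0 isT) (dy 1 isT) (dy 2 isT) (jw_neq0 R) (dy 3 isT)).
Qed.

Lemma gens_step n m : (4 < m.+2)%N -> jp m.+2 (gens n) = 0 ->
  jp m.+2 (gens n.+1) = jfactor * jp m.+1 (gens n).
Proof.
move=> m4 dn; rewrite gensS.
exact: (bracket_step (@jet_partialM R m.+2) (jet_partial_factor m4)
  (partial_total_bracket m (gens n)) dn (derivation0 (@total_derivD R))).
Qed.

(** The variable [n + 4] is y_(n+3). For a variable on which generator [n] does not depend, the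
    bracket with [D_x] leaves only the partial derivative one order lower, times the nonzero
    [jfactor]; so each step raises the order by exactly one. *)
Lemma gens_order n : (forall m, (n + 4 < m)%N -> jp m (gens n) = 0) /\
  jp (n + 4)%N (gens n) != 0.
Proof.
elim: n => [|n [IH0 IHn]].
  have e : gens 0 = iota_ R 1 ^+ 2 / iota_ R 0 ^+ 3 by [].
  rewrite e (iota1E (jw_neq0 R)); split=> [m m4|].
    have dx : jp m (jx R) = 0 := jet_partial_x (leq_trans (isT : 1 <= 5)%N m4).
    have dy l : (l < 4)%N -> jp m (jy R l) = 0.
      by move=> l4; apply: jet_partial_y; exact: leq_ltn_trans l4 m4.
    exact: (dker_J (@jet_partialD R m) (@jet_partialM R m) dx
      (dy 0 isT) (dy 1 isT) (dy 2 isT) (jw_neq0 R) (dy 3 isT)).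
  have dx : jp 4 (jx R) = 0 := @jet_partial_x 4 isT.
  have dy l : (l < 3)%N -> jp 4 (jy R l) = 0 := @jet_partial_y 4 l.
  have i10 := iota1_neq0 R; rewrite (iota1E (jw_neq0 R)) in i10.
  have d3 : jp 4 (jy R 3) = 1 := jet_partial_var R 4 4.
  exact: (dJ_neq0 (@jet_partialD R 4) (@jet_partialM R 4) dx (dy 0 isT) (dy 1 isT)
    (dy 2 isT) (jw_neq0 R) (iota0_neq0 R) i10 (jetfun_two_neq0 R) d3).
split=> [[|[|m]] // nm|].
  rewrite gens_step ?IH0 ?mulr0 //.
  - by apply: leq_trans nm; rewrite addnC.
  - by apply: leq_trans nm; rewrite addSn.
rewrite addSn addnS gens_step.
- by apply: mulf_neq0; [exact: jfactor_neq0|rewrite -addnS].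
- by rewrite -!addnS leq_addl.
- by apply: IH0; rewrite -!addnS.
Qed.

(** Allowing every sufficiently large truncation lets the bounds for two polynomials be merged. *)
Lemma jsub_gens_chain m p : exists N, forall n, (N <= n)%N ->
  chain_sum (jsub gens) (jp m) (@partial_deriv R) gens p n.
Proof.
elim/polyN_ind: p => [c|i|p q [N1 Hp] [N2 Hq]|p q [N1 Hp] [N2 Hq]].
- exists 0%N => n _; apply: chain_sum0 => [|j]; last exact: partial_deriv_const.
  exact: etrans (congr1 (jp m) (jsub_const gens c)) (jet_partial_const m c).
- exists i.+1 => n ni.
  exact: (@chain_sum_var (polyN R) (jetfun R) (jsub gens) (jp m) (@partial_deriv R)
    gens (varN R i) i n ni (jsub_var _ _) (fun j => @partial_deriv_var R j i)).
- exists (maxn N1 N2) => n; rewrite geq_max => /andP[n1 n2].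
  exact: (chain_sumD (@jet_partialD R m) (@partial_derivD R) (Hp n n1) (Hq n n2)).
- exists (maxn N1 N2) => n; rewrite geq_max => /andP[n1 n2].
  exact: (chain_sumM (@jet_partialM R m) (@partial_derivM R) (Hp n n1) (Hq n n2)).
Qed.

(** Characteristic zero: a nonconstant monomial contains some variable, and differentiating by it
    multiplies the coefficient by a positive integer. *)
Lemma partial_deriv_all0 p : (forall i, partial_deriv i p = 0) ->
  exists c, p = constN c.
Proof.
move=> dp; exists (mcoeff mone p); apply/malgP => m.
have e : mcoeff m (constN (mcoeff mone p)) = mcoeff mone p *+ (m == mone) := mcoeffC _ _.
rewrite e; case: eqP => [->|m1]; first by rewrite mulr1n.
rewrite mulr0n.
have [i im] : exists i, i \in finsupp m.
  apply/fset0Pn; apply: contra_notN m1 => /eqP fm.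
  by apply/eqP; rewrite -mdeg_eq0 mdegE fm big_seq_fset0.
have mi : m = mulcm (divcm m (ucm i)) (ucm i).
  apply/eqP/cmP => j; rewrite mulcmE divcmE ucmE subnK //.
  by have [<-|//] := eqVneq i j; rewrite lt0n cmE_neq0.
have := mcoeff_partial_deriv i (divcm m (ucm i)) p; rewrite dp -mi mcoeff0.
by move/esym/eqP; rewrite mulrn_eq0 => /eqP.
Qed.

Lemma partial_deriv_deg i p n : (forall m, m \in msupp p -> mdeg m < n.+1)%N ->
  (forall m, m \in msupp (partial_deriv i p) -> mdeg m < n)%N.
Proof.
move=> pn m; rewrite -mcoeff_neq0 mcoeff_partial_deriv => mp.
have /pn : mulcm m (ucm i) \in msupp p.
  by rewrite -mcoeff_neq0; apply: contraNneq mp => ->; rewrite mul0rn.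
by rewrite mdegM mdegU addn1 ltnS.
Qed.

(** Induction on a degree bound: the partial derivatives of a relation have smaller degree and are
    again relations, hence zero. The relation is then a constant, whose image vanishes only if it is
    zero. *)
Theorem gens_free p : jsub gens p = 0 -> p = 0.
Proof.
have [n pn] : exists n, (forall m, m \in msupp p -> mdeg m < n)%N.
  exists (\max_(m <- msupp p) (mdeg m).+1)%N => m mp.
  exact: (leq_bigmax_seq _ mp isT).
elim: n p pn => [|n IHn] p pn p0.
  apply/eqP; rewrite -msupp_eq0; apply/eqP/fsetP => m; rewrite in_fset0.
  by apply/negP => /pn.
(* Descending induction on the variable, [k] bounding its distance below [var_bound p]: the partial
   derivatives above [i] must already be zero for the chain rule to reduce to one term. *)
have dp0 k i : (var_bound p <= i + k)%N -> partial_deriv i p = 0.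
  elim: k i => [|k IHk] i; first by rewrite addn0; exact: partial_deriv_eq0.
  rewrite addnS => bk; apply: IHn; first exact: partial_deriv_deg.
  have [N HN] := jsub_gens_chain (i + 4) p.
  have lti : (i < maxn N i.+1)%N by rewrite leq_max leqnn orbT.
  apply: (chain_sum_top (@jet_partialD R (i + 4)) lti (HN _ (leq_maxl _ _)) p0).
  - move=> j ij; apply: IHk; apply: leq_trans bk _.
    by rewrite -addSn leq_add2r.
  - by move=> j ji; apply: (gens_order j).1; rewrite ltn_add2r.
  - exact: (gens_order i).2.
have [c pc] : exists c, p = constN c.
  by apply: partial_deriv_all0 => i; apply: (dp0 (var_bound p)); exact: leq_addl.
move: p0; rewrite pc jsub_const => /eqP; rewrite (fmorph_eq0 (@jconst R)) => /eqP ->.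
exact: (rmorph0 (@constN R)).
Qed.

End Freeness.

(** * Invariance of the generated field and conclusion *)

Section FixedImage.

Variables (P : comNzRingType) (K : fieldType) (s : {rmorphism P -> K}).
Variable f : {rmorphism K -> K}.

Lemma fixed_imageD p q : f (s p) = s p -> f (s q) = s q -> f (s (p + q)) = s (p + q).
Proof. by move=> fp fq; rewrite !rmorphD fp fq. Qed.

Lemma fixed_imageM p q : f (s p) = s p -> f (s q) = s q -> f (s (p * q)) = s (p * q).
Proof. by move=> fp fq; rewrite !rmorphM fp fq. Qed.

End FixedImage.

Section Invariance.

Variable R : realType.
Implicit Types (p q : polyN R) (F G : jetfun R).

Local Notation gens := (gens R).
Local Notation nab' := (@jnab' R).

Section Fixed.

Variables (h : 'M[R]_2 * R) (phi : {rmorphism jetfun R -> jetfun R}).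
Hypothesis hC : CSp2 h.
Hypothesis phiE : forall p, phi (to_jetfun p) = jsub (prol_coord h) p.

Lemma phi_jnab' F : phi (nab' F) = nab' (phi F).
Proof.
have [_ H _] := csp_phi_weights hC phiE (jw_neq0 R) (y2_neq0 R) (iota1_neq0 R).
exact: H.
Qed.

Lemma phi_gens j : phi (gens j) = gens j.
Proof.
have [_ _ H] := csp_phi_weights hC phiE (jw_neq0 R) (y2_neq0 R) (iota1_neq0 R).
elim: j => [|j IHj]; first exact: H.
have e : gens j.+1 = nab' (gens j) := erefl.
by rewrite e phi_jnab' IHj.
Qed.

Lemma phi_jsub_gens p : phi (jsub gens p) = jsub gens p.
Proof.
elim/polyN_ind: p => [c|j|p q Hp Hq|p q Hp Hq].
- rewrite jsub_const; exact: csp_phi_const phiE c.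
- rewrite jsub_var; exact: phi_gens.
- exact: (fixed_imageD (s := jsub gens) Hp Hq).
- exact: (fixed_imageM (s := jsub gens) Hp Hq).
Qed.

End Fixed.

(** [phi F] takes at [u] the value of [F] at [v], and [phi] fixes the whole generated field. *)
Lemma frac_image_invariant F : frac_image (jsub gens) F -> differential_invariant F.
Proof.
move=> EF u v [h hC uv] b c Fu Fv; have [phi phiE] := csp_morphism hC.
have := csp_phi_value hC phiE uv Fv.
rewrite (frac_image_fixed (s := jsub gens) (phi_jsub_gens hC phiE) EF).
exact: value_unique.
Qed.

(** A pullback of [F] by [h] can only be [phi F], so invariance of the derivation is its commutation
    with [phi]. *)
Lemma jnab'_invariant_derivation : invariant_derivation nab'.
Proof.
split; first by exists (jfactor R) => F; exact: mulrA.
move=> h hC F G FG; have [phi phiE] := csp_morphism hC.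
rewrite (is_pullback_eq hC phiE FG) -(phi_jnab' hC phiE F).
exact: csp_phi_pullback.
Qed.

Lemma jJ_freely_generates : freely_generated (jJ R) nab'.
Proof.
split.
- apply: frac_image_invariant; exact: (@E_gen R 0).
- exact: jnab'_invariant_derivation.
- by move=> F; split; [exact: invariant_generated|exact: frac_image_invariant].
- exact: gens_free.
Qed.

End Invariance.

Theorem mainTheorem10 (R : realType) :
  let x := jx R in
  let y := jy R 0 in
  let y1 := jy R 1 in
  let y2 := jy R 2 in
  let I2 := y2 / (x * y1 - y) ^+ 3 in
  let nabla F := 1 / (x * y1 - y) * total_deriv F in
  let I3 := nabla I2 in
  let I3' := I3 ^+ 2 / I2 ^+ 3 in
  let nabla' F := I2 / I3 * nabla F in
  freely_generated I3' nabla'.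
Proof. exact: jJ_freely_generates. Qed.
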